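(* Let $\Omega=\{(x,y):x^2+y^2\le1\}$, $M>0$, and let $u:\Omega\to\mathbb{R}$ be a concave function with $0\le u(x,y)\le M$. Assume that in some nonempty open subset of $\Omega$ the function $u$ is of class $C^2$ and the matrix of second derivatives $D^2u$ is non-degenerate (and therefore negative definite). Consider the problem of minimizing $$\iint_\Omega\frac{1}{1+|\nabla w(x,y)|^2}\,dx\,dy\qquad( * )$$ in the class of concave functions $w:\Omega\to\mathbb{R}$ satisfying $0\le w(x,y)\le M$. Then either $u$ is not a solution to $( * )$, or the following holds: denoting by $\nu$ the measure corresponding to $u$, there exists an infinite-dimensional linear space $\mathcal M$ of signed measures on $S^2$ such that for any $\nu'\in\mathcal M$ there is some $\varepsilon(\nu')>0$ such that all measures $\nu+s\nu'$, $s\in[-\varepsilon(\nu'),\varepsilon(\nu')]$, correspond to solutions of $( * )$.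
   Context: The surface measure of a convex compact body $C\subset\mathbb{R}^3$ is the Borel measure on $S^2$ that is the pushforward of the 2-dimensional Hausdorff measure on $\partial C$ under the map sending a regular point $\xi\in\partial C$ to the outer unit normal $n_\xi$. The measure corresponding to a concave function $w:\Omega\to[0,M]$ is the surface measure of the convex body $\{(x,y,z):(x,y)\in\Omega,\ 0\le z\le w(x,y)\}$. ''Open subset of $\Omega$'' means a subset of $\Omega$ that is open in $\mathbb{R}^2$. *)

(* Defs.v *)
From HB Require Import structures.
From mathcomp Require Import all_boot all_order all_algebra.
From mathcomp Require Import all_classical all_reals all_analysis.
Set Implicit Arguments.
Unset Strict Implicit.
Unset Printing Implicit Defensive.
Import Order.TTheory GRing.Theory Num.Theory.
Import numFieldNormedType.Exports.
Local Open Scope classical_set_scope.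
Local Open Scope ring_scope.

(* The plane is [R * R] and space is [R * R * R]. Their library norm is the sup
   norm, so the Euclidean structure is given explicitly; the topology is the
   same. *)

Section Plane.
Context {R : realType}.
Implicit Types (w f : R * R -> R) (p : R * R) (U : set (R * R)) (M : R).

Definition unit_disc : set (R * R) := [set p | p.1 ^+ 2 + p.2 ^+ 2 <= 1].

Definition concave_on (D : set (R * R)) w : Prop :=
  convex_function D (fun p => - w p).

Definition dirvec (i : 'I_2) : R * R := if i == ord0 then (1, 0) else (0, 1).

Definition partial (i : 'I_2) f : R * R -> R := 'D_(dirvec i) f.

Definition hessian f p : 'M[R]_2 := \matrix_(i, j) partial i (partial j f) p.

(* For [U] open. *)
Definition C2_on U f : Prop := forall p, U p ->
  {for p, continuous f} /\
  forall i j,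
    [/\ derivable f p (dirvec i),
        {for p, continuous (partial i f)},
        derivable (partial i f) p (dirvec j)
      & {for p, continuous (partial j (partial i f))}].

(* A concave function on the disc is differentiable almost everywhere; the
   arbitrary values of [partial] at the other points, and on the boundary
   circle, where they depend on the extension of [w] to the plane, do not
   affect the integral. *)
Definition resistance w : \bar R :=
  (\int[lebesgue_measure \x lebesgue_measure]_(p in unit_disc)
    ((1 + (partial ord0 w p ^+ 2 + partial ord_max w p ^+ 2))^-1)%:E)%E.

Definition admissible M w : Prop :=
  concave_on unit_disc w /\ forall p, unit_disc p -> 0 <= w p <= M.

Definition is_solution M w : Prop :=
  admissible M w /\
  forall w', admissible M w' -> (resistance w <= resistance w')%E.

Definition subgraph w : set (R * R * R) :=
  [set q | unit_disc q.1 /\ 0 <= q.2 <= w q.1].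

End Plane.

Section Space.
Context {R : realType}.
Implicit Types (x y xi : R * R * R) (A C : set (R * R * R)).

Definition dotp x y : R := x.1.1 * y.1.1 + x.1.2 * y.1.2 + x.2 * y.2.

Definition edist x y : R := Num.sqrt (dotp (x - y) (x - y)).

(* The adjoined 0 only makes the diameter of the empty set 0 instead of -oo. *)
Definition diameter A : \bar R :=
  ereal_sup (0%E |` [set (edist x y)%:E | x in A & y in A]).

Definition hausdorff2_pre (d : R) A : \bar R :=
  ereal_inf
    [set (\sum_(0 <= k <oo) (pi / 4)%:E * diameter (F k) ^+ 2)%E
    | F in [set F : nat -> set (R * R * R) |
            A `<=` \bigcup_k F k /\ forall k, (diameter (F k) <= d%:E)%E]].

(* The factor pi / 4 normalizes the measure to agree with area on planes. *)
Definition hausdorff2 A : \bar R :=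
  ereal_sup [set hausdorff2_pre d A | d in [set d | 0 < d]].

Definition boundary C : set (R * R * R) := closure C `\` interior C.

Definition unit_sphere : set (R * R * R) := [set x | dotp x x = 1].

Lemma unit_sphere_north : ((0, 0, 1) : R * R * R) \in unit_sphere.
Proof. by rewrite inE /unit_sphere /dotp /= !mul0r !add0r mulr1. Qed.

End Space.

Definition sphere_type (R : realType) : Type := set_type (@unit_sphere R).

HB.instance Definition _ (R : realType) :=
  Topological.copy (sphere_type R) (set_type (@unit_sphere R)).
HB.instance Definition _ (R : realType) :=
  isPointed.Build (sphere_type R) (SigSub (@unit_sphere_north R)).

Definition S2 (R : realType) := g_sigma_algebraType (@open (sphere_type R)).

Section SurfaceMeasure.
Context {R : realType}.
Implicit Types (C : set (R * R * R)) (xi : R * R * R) (n : S2 R).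

Definition outer_normal C xi n : Prop :=
  forall x, C x -> dotp (set_val n) (x - xi) <= 0.

Definition regular_point C xi : Prop :=
  boundary C xi /\ exists! n, outer_normal C xi n.

(* [C] and its closure have the same boundary (when [C] is convex with nonempty
   interior) and the same outer normals, so [C] need not be closed; this matters
   because the subgraph of a concave function that is not upper semicontinuous
   at the circle is not closed. *)
Definition surface_measure C (A : set (S2 R)) : \bar R :=
  hausdorff2 [set xi | regular_point C xi /\ exists2 n, A n & outer_normal C xi n].

Definition corresponding_measure (w : R * R -> R) : set (S2 R) -> \bar R :=
  surface_measure (subgraph w).

End SurfaceMeasure.

Section SignedMeasures.
Context {d : measure_display} {T : measurableType d} {R : realType}.
Local Notation charges := ({charge set T -> \bar R}) (only parsing).
Implicit Types (L : set charges) (mu : charges).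

Definition linear_space L : Prop :=
  [/\ L czero,
      forall mu1 mu2, L mu1 -> L mu2 -> L (cadd mu1 mu2)
    & forall (a : R) mu, L mu -> L (cscale a mu)].

(* A charge is a function on all subsets of [T], but as a signed measure only
   its values on measurable sets count. *)
Definition lin_indep (k : nat) (mu : 'I_k -> charges) : Prop :=
  forall a : 'I_k -> R,
    (forall A, measurable A -> (\sum_(i < k) (a i)%:E * mu i A = 0)%E) ->
    forall i, a i = 0.

Definition infinite_dimensional L : Prop :=
  forall k, exists mu : 'I_k -> charges,
    (forall i, L (mu i)) /\ lin_indep mu.

End SignedMeasures.

(* Main.v *)
Require Import Defs.
From mathcomp Require Import all_boot all_order all_algebra.
From mathcomp Require Import all_classical all_reals all_analysis.
From mathcomp Require Import measurable_realfun ring lra.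
Import Order.TTheory GRing.Theory Num.Theory.
Import numFieldNormedType.Exports.
Local Open Scope classical_set_scope.
Local Open Scope ring_scope.

(* The first alternative always holds.  Near a suitable point [u] is strongly
   concave with [0 < u < M], so [u + t phi] is admissible for small [|t|]
   whenever [phi] is a C^{1,1} function supported in a small square, and optimality
   forces the second difference of the resistance to be nonnegative.  The density
   [1 / (1 + |xi|^2)] is strictly concave at [xi = grad u] in the directions close
   to the unit vector [tau] orthogonal to [xi].  With a bump [chi], the functions
   [phi = chi cos (N tau . x)] and [chi sin (N tau . x)] oscillate in the direction
   [tau]; adding their second differences makes [cos^2 + sin^2 = 1] remove the
   oscillation, leaving pointwise at most [t^2 (16 |grad chi|^2 - c N^2 chi^2)] for
   some [c > 0], whose integral is negative for large [N]. *)

Set Implicit Arguments.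
Unset Strict Implicit.
Unset Printing Implicit Defensive.

(** Competitors must be concave on the whole disc, while [u] is controlled only near one point. So
    the negative Hessian is first turned into a quadratic gap below the tangent plane that holds at
    every point of the disc, and segments leaving the neighbourhood need a gluing argument. With
    [A = 1 + |xi|^2], the second derivative of the density along [eta] is
    [8 (xi . eta)^2 / A^3 - 2 |eta|^2 / A^2], whence the role of directions orthogonal to [xi]. The
    gradient of [phi] has a part of size [N chi] along [tau], which gives the gain, and a part of
    size [|grad chi|], which gives the loss. The order of choices matters: [N] depends only on [chi]
    and on the gradient of [u] at the base point, and [t] comes afterwards, since the C^{1,1} bounds
    of [phi] grow with [N]. The integrands are not shown to be measurable, so integrals are treated
    as suprema over simple functions; superadditivity, together with measurable bounds for gain and
    loss, is enough for the comparison. *)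

Section LowerIntegral.
Context d (T : measurableType d) (R : realType) (mu : {measure set T -> \bar R}).
Import HBNNSimple.

(** The library integral of a nonnegative function is by definition this supremum, whether or not
    the function is measurable; the bounds for general integrands below are derived from it. *)
Lemma ge0_integral_ereal_sup (f : T -> R) : (forall x, 0 <= f x) ->
  (\int[mu]_x (f x)%:E)%E =
  ereal_sup [set sintegral mu h | h in
    [set h : {nnsfun T >-> R} | forall x, h x <= f x]].
Proof.
move=> f0; rewrite ge0_integralTE//.
Qed.

Lemma le_integral_ge0 (g f : T -> R) :
  (forall x, 0 <= g x) -> (forall x, g x <= f x) ->
  (\int[mu]_x (g x)%:E <= \int[mu]_x (f x)%:E)%E.
Proof.
move=> g0 gf; rewrite !ge0_integral_ereal_sup//.
  by apply: le_ereal_sup => _ [k kg <-]; exists k => // x; exact: le_trans (gf x).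
by move=> x; exact: le_trans (gf x).
Qed.

Lemma lt_integral_nnsfun (f : T -> R) (r : R) : (forall x, 0 <= f x) ->
  (r%:E < \int[mu]_x (f x)%:E)%E ->
  exists2 k : {nnsfun T >-> R}, (forall x, k x <= f x) &
    (r%:E < \int[mu]_x (k x)%:E)%E.
Proof.
move=> f0; rewrite ge0_integral_ereal_sup// => /ereal_sup_gt[_ [k kf <-] rk].
by exists k => //; rewrite integralT_nnsfun.
Qed.

(* No measurability of [f0] and [f i]: these integrals are lower integrals. *)
Lemma lower_integral_comparison n (f0 : T -> R) (f : 'I_n.+1 -> T -> R)
    (h1 h2 : T -> R) :
  (forall x, 0 <= f0 x) -> (forall i x, 0 <= f i x) ->
  measurable_fun setT h1 -> measurable_fun setT h2 ->
  (forall x, 0 <= h1 x) -> (forall x, 0 <= h2 x) ->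
  (\int[mu]_x (f0 x)%:E < +oo)%E ->
  (forall i, \int[mu]_x (f0 x)%:E <= \int[mu]_x (f i x)%:E)%E ->
  (forall x, \sum_i f i x + h1 x <= n.+1%:R * f0 x + h2 x) ->
  (\int[mu]_x (h1 x)%:E <= \int[mu]_x (h2 x)%:E)%E.
Proof.
move=> f00 f_ge0 mh1 mh2 h10 h20 fin0 minf sumf.
have I0 : (0 <= \int[mu]_x (f0 x)%:E)%E by apply: integral_ge0 => x _; rewrite lee_fin.
set J := (\int[mu]_x (f0 x)%:E)%E in I0 fin0 minf.
have Jfin : J \is a fin_num by rewrite ge0_fin_numE.
apply/lee_addgt0Pr => e e0.
(* Each of the [n.+1] integrals gives up [e / n.+1], so the total loss is [e]. *)
pose r := fine J - e / n.+1%:R.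
have rJ : (r%:E < J)%E.
  by rewrite -(fineK Jfin) lte_fin /r ltrBlDr ltrDl divr_gt0.
have /choice[k kP] : forall i, exists k : {nnsfun T >-> R}, (forall x, k x <= f i x) /\
    (r%:E < \int[mu]_x (k x)%:E)%E.
  move=> i; have [|k ? ?] := @lt_integral_nnsfun (f i) r (f_ge0 i).
    exact: lt_le_trans (minf i).
  by exists k.
pose s x := \sum_i k i x.
have ms : measurable_fun setT s by apply: measurable_sum => i; exact: measurable_funPT.
have s0 x : 0 <= s x by apply: sumr_ge0.
(* With simple minorants [k i] in place of the [f i], [sumf] yields a measurable minorant [g] of
   [f0], and [g], [h1], [h2] can be integrated additively. *)
pose g x := n.+1%:R^-1 * Num.max (s x + h1 x - h2 x) 0.
have mg : measurable_fun setT g.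
  apply: measurable_funM => //; apply: measurable_maxr => //.
  by apply: measurable_funB => //; exact: measurable_funD.
have g0 x : 0 <= g x by rewrite mulr_ge0// le_max lexx orbT.
have gf0 x : g x <= f0 x.
  rewrite /g mulrC ler_pdivrMr// ge_max mulr_ge0// andbT mulrC lerBlDr.
  by apply: le_trans (sumf x); rewrite lerD2r; apply: ler_sum => i _; exact: (kP i).1.
have gJ : (\int[mu]_x (g x)%:E <= J)%E by exact: le_integral_ge0.
have key : (\int[mu]_x (s x)%:E + \int[mu]_x (h1 x)%:E <=
    n.+1%:R%:E * \int[mu]_x (g x)%:E + \int[mu]_x (h2 x)%:E)%E.
  have mE (h : T -> R) : measurable_fun setT h -> measurable_fun setT (EFin \o h).
    by move=> ?; exact/measurable_EFinP.
  rewrite -ge0_integralZl//; [|exact: mE|by move=> *; rewrite lee_fin].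
  have mng : measurable_fun setT (fun x => n.+1%:R * g x) by exact: measurable_funM.
  rewrite -!ge0_integralD//; do ?[exact: mE]; 
    do ?[by move=> *; rewrite lee_fin];
    do ?[by move=> x _; rewrite -EFinM lee_fin; apply: mulr_ge0].
  apply: ge0_le_integral => //;
    do ?[by move=> *; rewrite -?EFinM -?EFinD lee_fin ?addr_ge0 ?mulr_ge0].
  - by apply: (mE (s \+ h1)); exact: measurable_funD.
  - by apply: (mE (_ \+ h2)); exact: measurable_funD.
  move=> x _; rewrite -EFinM -!EFinD lee_fin /g mulrA divff// mul1r.
  by rewrite -lerBlDr le_max lexx.
have sumk : ((n.+1%:R * r)%:E <= \int[mu]_x (s x)%:E)%E.
  under eq_integral do rewrite /s -sumEFin.
  rewrite ge0_integral_sum//;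
    [|by move=> i; apply/measurable_EFinP; exact: measurable_funPT
     |by move=> i x _; rewrite lee_fin].
  apply: (@le_trans _ _ (\sum_(i < n.+1) r%:E)%E).
    by rewrite sumEFin sumr_const card_ord mulr_natl.
  by apply: lee_sum => i _; exact/ltW/(kP i).2.
have key' : ((n.+1%:R * r)%:E + \int[mu]_x (h1 x)%:E <=
    (n.+1%:R * fine J)%:E + \int[mu]_x (h2 x)%:E)%E.
  apply: le_trans (leeD sumk (lexx _)) _; apply: (le_trans key).
  rewrite leeD2r//.
  by rewrite EFinM fineK// lee_wpmul2l.
move: key'; have -> : (n.+1%:R * fine J = n.+1%:R * r + e)%R.
  by rewrite /r mulrBr mulrCA mulfV// mulr1 subrK.
by rewrite EFinD -addeA leeD2lE// addeC.
Qed.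
End LowerIntegral.

(** * Second-order Taylor estimates in the plane *)

Section Taylor.
Context {R : realType}.
Implicit Types (f : R * R -> R) (p c : R * R) (U : set (R * R)).

(** Writing the segment from [0] to [s] as [a * s] with [a] in [[0, 1]] treats both signs of [s] at
    once. *)
Lemma mean_value_bound (g dg : R -> R) (s L : R) :
  (forall a, 0 <= a <= 1 -> is_derive (a * s) 1 g (dg (a * s))) ->
  (forall a, 0 <= a <= 1 -> `|dg (a * s)| <= L) ->
  `|g s - g 0| <= L * `|s|.
Proof.
move=> gd gL.
have dG (a : R) : 0 <= a <= 1 ->
    is_derive a (1 : R) (g \o (fun x => x * s)) (dg (a * s) * s).
  move=> a01; apply: is_derive1_comp; first exact: gd.
  have -> : (fun x : R => x * s) = s \*: (id : R -> R).
    by apply/funext => x /=; rewrite mulrC.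
  by apply: is_derive_eq; rewrite [LHS]mulr1.
have [|||c] := @MVT_segment R (g \o (fun x => x * s)) (fun a => dg (a * s) * s) 0 1.
- by [].
- by move=> x; rewrite in_itv/= => /andP[x0 x1]; apply: dG; rewrite !ltW.
- apply: derivable_within_continuous => x; rewrite in_itv/= => x01.
  exact: (@ex_derive _ _ _ _ _ _ _ (dG x x01)).
rewrite in_itv/= => c01; rewrite mul1r mul0r subr0 mulr1 => ->.
by rewrite normrM ler_wpM2r//; exact: gL.
Qed.

(** [A] is any constant close to [g2] on the segment, later a second derivative at a fixed base
    point. Subtracting the quadratic polynomial leaves [G]; one mean value bound estimates its
    derivative by [e |s|], a second one estimates [G] itself. *)
Lemma taylor2_bound (g g1 g2 : R -> R) (s A e : R) :
  (forall a, 0 <= a <= 1 -> is_derive (a * s) 1 g (g1 (a * s))) ->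
  (forall a, 0 <= a <= 1 -> is_derive (a * s) 1 g1 (g2 (a * s))) ->
  (forall a, 0 <= a <= 1 -> `|g2 (a * s) - A| <= e) ->
  `|g s - g 0 - s * g1 0 - A * s ^+ 2 / 2| <= e * s ^+ 2.
Proof.
move=> dg dg1 g2A.
pose G x := g x - (g1 0 * x + A / 2 * x ^+ 2).
have e0 : 0 <= e by apply: le_trans (g2A 0 _); rewrite // lexx ler01.
have Gd a : 0 <= a <= 1 -> is_derive (a * s) 1 G (g1 (a * s) - (g1 0 + A * (a * s))).
  move=> a01; rewrite /G; have := dg a a01; move: (a * s) => b dgb.
  pose q := (g1 0 \*: (id : R -> R) + (A / 2) \*: (fun x : R => x ^+ 2)).
  have -> : (fun x : R => g x - (g1 0 * x + A / 2 * x ^+ 2)) = g - q by [].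
  apply: is_derive_eq; rewrite /q.
  congr (_ - (_ + _)); first by rewrite [LHS]mulr1.
  by rewrite /GRing.scale/=; field.
have GL a : 0 <= a <= 1 -> `|g1 (a * s) - (g1 0 + A * (a * s))| <= e * `|s|.
  move=> /andP[a0 a1].
  pose K x := g1 x - A * x.
  have -> : g1 (a * s) - (g1 0 + A * (a * s)) = K (a * s) - K 0 by rewrite /K; ring.
  apply: (@le_trans _ _ (e * `|a * s|)); last first.
    by rewrite ler_wpM2l// normrM ler_piMl// ger0_norm.
  have b01 (b : R) : 0 <= b <= 1 -> 0 <= b * a <= 1.
    by move=> /andP[b0 b1]; rewrite mulr_ge0//= mulr_ile1.
  apply: (@mean_value_bound _ (fun x => g2 x - A)) => b /b01 ba01; rewrite mulrA; last exact: g2A.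
  have dd := dg1 _ ba01.
  have -> : K = g1 - A \*: (id : R -> R) by [].
  by apply: is_derive_eq; congr (_ - _); rewrite [LHS]mulr1.
have := @mean_value_bound G (fun x => g1 x - (g1 0 + A * x)) _ _ Gd GL.
rewrite -(mulrA e) -expr2 real_normK ?num_real//.
by apply: le_trans; rewrite le_eqVlt; apply/orP; left; apply/eqP; congr (`|_|); rewrite /G; field.
Qed.

Lemma line_is_derive f p v s : derivable f (p + s *: v) v ->
  is_derive s 1 (fun x => f (p + x *: v)) ('D_v f (p + s *: v)).
Proof.
have E : (fun h : R => h^-1 *: (((fun x => f (p + x *: v)) \o shift s) (h *: (1 : R)) -
      f (p + s *: v))) =
    (fun h : R => h^-1 *: ((f \o shift (p + s *: v)) (h *: v) - f (p + s *: v))).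
  apply/funext => h /=; congr (_ *: (f _ - _)).
  by rewrite [h *: _]mulr1 scalerDl addrCA.
move=> fd; split; first by rewrite /derivable E.
by rewrite /derive E.
Qed.

Definition square p (r : R) : set (R * R) :=
  [set q | `|q.1 - p.1| <= r /\ `|q.2 - p.2| <= r].

Lemma nbhs_squareP p (P : set (R * R)) :
  nbhs p P <-> exists2 r, 0 < r & square p r `<=` P.
Proof.
split.
  move=> /nbhs_ballP[e /= e0 eP]; exists (e / 2); first by rewrite divr_gt0.
  move=> q [q1 q2]; apply: eP; split; rewrite /ball/= distrC.
    by apply: (le_lt_trans q1); rewrite ltr_pdivrMr// ltr_pMr// ltr1n.
  by apply: (le_lt_trans q2); rewrite ltr_pdivrMr// ltr_pMr// ltr1n.
move=> [e e0 eP]; apply/nbhs_ballP; exists e => // q [q1 q2]; apply: eP.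
by split; rewrite distrC ltW.
Qed.

Lemma square_le p r r' : r <= r' -> square p r `<=` square p r'.
Proof. by move=> rr' q [q1 q2]; split; exact: le_trans rr'. Qed.

Lemma dirvecE (i : 'I_2) : dirvec i = (1, 0) :> R * R \/ dirvec i = (0, 1) :> R * R.
Proof. by rewrite /dirvec; case: ifP => _; [left|right]. Qed.

Lemma square_dirvec p c r r' i (h : R) : square p r c -> `|h| <= r' ->
  square p (r + r') (c + h *: dirvec i).
Proof.
move=> [c1 c2] hr; have r'0 : 0 <= r' by exact: le_trans hr.
have D (a b x : R) : `|a - b| <= r -> `|x| <= r' -> `|a + x - b| <= r + r'.
  by move=> ab xr; rewrite addrAC; apply: (le_trans (ler_normD _ _)); exact: lerD.
split; apply: D => //=; rewrite /GRing.scale/=; case: (dirvecE i) => -> /=;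
  by rewrite ?mulr1 ?mulr0 ?normr0.
Qed.

Lemma square_sub p r c r' : square p r c -> square c r' `<=` square p (r + r').
Proof.
move=> [c1 c2] q [q1 q2]; split.
  by rewrite -(subrKA c.1) [leRHS]addrC; apply: (le_trans (ler_normD _ _)); exact: lerD.
by rewrite -(subrKA c.2) [leRHS]addrC; apply: (le_trans (ler_normD _ _)); exact: lerD.
Qed.

Lemma near_dist_le (F : R * R -> R) p (e : R) : {for p, continuous F} -> 0 < e ->
  \forall q \near p, `|F q - F p| <= e.
Proof.
move=> /cvgr_dist_le/(_ e) cF /cF; apply: filterS => q.
by rewrite distrC.
Qed.

(** The second-order coefficients are frozen at [p] while the expansion point [c] varies, so one
    radius serves all [c] near [p]. The path goes along axis [j], then along axis [i], and so
    involves a single order of the mixed derivative; symmetry is deduced later by exchanging the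
    axes. *)
Lemma C2_taylor U f p (i j : 'I_2) (e : R) : open U -> C2_on U f -> U p -> 0 < e ->
  exists2 r, 0 < r & forall c q h k, square p r c -> `|h| <= r -> `|k| <= r ->
   q = c + h *: dirvec i + k *: dirvec j ->
   `|f q - f c - h * partial i f c - k * partial j f c
    - (partial i (partial i f) p * h ^+ 2 / 2 + partial j (partial i f) p * h * k
       + partial j (partial j f) p * k ^+ 2 / 2)| <= e * (h ^+ 2 + k ^+ 2).
Proof.
move=> oU fC2 Up e0.
pose near_p l m q := `|partial m (partial l f) q - partial m (partial l f) p| <= e / 2.
have nearU : \near p, U p by exact: open_nbhs_nbhs.
have near_lm l m : \near p, near_p l m p.
  have [_ /(_ l m)[_ _ _ clm]] := fC2 p Up.
  by apply: (near_dist_le clm); rewrite divr_gt0.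
have /nbhs_squareP[r r0 rP] : nbhs p (U `&` (near_p i i `&` (near_p i j `&` near_p j j))).
  exact: (filterI nearU (filterI (near_lm i i) (filterI (near_lm i j) (near_lm j j)))).
(* One third for the position of [c] and one for each leg: the whole path stays in [square p r]. *)
exists (r / 3); first by rewrite divr_gt0.
move=> c q h k cr hr kr -> {q}.
have r3 : r / 3 + r / 3 + r / 3 = r by field.
have seg a s : 0 <= a <= 1 -> `|s| <= r / 3 -> `|a * s| <= r / 3.
  move=> /andP[a0 a1] sr; rewrite normrM; apply: le_trans sr.
  by rewrite ler_piMl// ger0_norm.
have Pc a s l : 0 <= a <= 1 -> `|s| <= r / 3 -> 
    square p (r / 3 + r / 3) (c + (a * s) *: dirvec l).
  by move=> a01 sr; apply: square_dirvec => //; exact: seg.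
have Pcc a : 0 <= a <= 1 ->
    square p r (c + k *: dirvec j + (a * h) *: dirvec i).
  move=> a01; rewrite -r3; apply: square_dirvec; last exact: seg.
  by rewrite -[k]mul1r; apply: Pc; rewrite // lexx ler01.
have Pcr a s l : 0 <= a <= 1 -> `|s| <= r / 3 -> square p r (c + (a * s) *: dirvec l).
  move=> a01 sr; apply: square_le (Pc a s l a01 sr).
  by rewrite -[leRHS]r3 lerDl divr_ge0// ltW.
have dU l q : U q -> derivable f q (dirvec l).
  by move=> Uq; have [_ /(_ l l)[]] := fC2 q Uq.
have dUU l m q : U q -> derivable (partial l f) q (dirvec m).
  by move=> Uq; have [_ /(_ l m)[]] := fC2 q Uq.
(* [T1] expands the leg along [i] and [T2] the leg along [j]; [T3] brings the slope in direction [i]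
   back to [c], which produces the mixed term. *)
have T1 : `|f (c + k *: dirvec j + h *: dirvec i) - f (c + k *: dirvec j)
    - h * partial i f (c + k *: dirvec j) - partial i (partial i f) p * h ^+ 2 / 2| <= e / 2 * h ^+ 2.
  have := @taylor2_bound (fun x => f (c + k *: dirvec j + x *: dirvec i))
    (fun x => partial i f (c + k *: dirvec j + x *: dirvec i))
    (fun x => partial i (partial i f) (c + k *: dirvec j + x *: dirvec i))
    h (partial i (partial i f) p) (e / 2).
  rewrite scale0r addr0; apply=> a a01; have [Uq [nii _]] := rP _ (Pcc a a01).
  - by apply: line_is_derive; exact: dU.
  - by apply: line_is_derive; exact: dUU.
  - exact: nii.
have T2 : `|f (c + k *: dirvec j) - f c
    - k * partial j f c - partial j (partial j f) p * k ^+ 2 / 2| <= e / 2 * k ^+ 2.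
  have := @taylor2_bound (fun x => f (c + x *: dirvec j))
    (fun x => partial j f (c + x *: dirvec j))
    (fun x => partial j (partial j f) (c + x *: dirvec j))
    k (partial j (partial j f) p) (e / 2).
  rewrite scale0r addr0; apply=> a a01; have [Uq [_ [_ njj]]] := rP _ (Pcr a k j a01 kr).
  - by apply: line_is_derive; exact: dU.
  - by apply: line_is_derive; exact: dUU.
  - exact: njj.
have T3 : `|partial i f (c + k *: dirvec j) - partial i f c
    - partial j (partial i f) p * k| <= e / 2 * `|k|.
  pose b := partial j (partial i f) p.
  pose K x := partial i f (c + x *: dirvec j) - b * x.
  have -> : partial i f (c + k *: dirvec j) - partial i f c - b * k = K k - K 0.
    by rewrite /K scale0r addr0 mulr0 subr0 addrAC.
  apply: (@mean_value_bound K (fun x => partial j (partial i f) (c + x *: dirvec j) - b)) => a a01;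
    have [Uq [_ [nij _]]] := rP _ (Pcr a k j a01 kr); last exact: nij.
  have dd := line_is_derive (dUU i j _ Uq).
  have -> : K = (fun x => partial i f (c + x *: dirvec j)) - b \*: (id : R -> R) by [].
  by apply: is_derive_eq; congr (_ - _); rewrite [LHS]mulr1.
rewrite (addrAC c).
set F1 := f (_ + _ + _) in T1 *; set F2 := f (c + _) in T1 T2 *.
set F3 := f c in T2 *; set P1 := partial i f (c + _) in T1 T3.
move: T1 T2 T3; set P2 := partial i f c; set P3 := partial j f c.
set a := partial i _ _; set b := partial j (partial i f) p; set d := partial j (partial j f) p.
set X := F1 - _ - _ - _; set Y := F2 - _ - _ - _; set Z := P1 - _ - _ => T1 T2 T3.
have -> : F1 - F3 - h * P2 - k * P3 - (a * h ^+ 2 / 2 + b * h * k + d * k ^+ 2 / 2)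
   = X + Y + h * Z by rewrite /X /Y /Z; ring.
have hk : `|h * Z| <= e / 2 * (h ^+ 2 + k ^+ 2).
  rewrite normrM; apply: (@le_trans _ _ (`|h| * (e / 2 * `|k|))); first by rewrite ler_wpM2l.
  rewrite mulrCA ler_pM2l ?divr_gt0// -[h ^+ 2]real_normK ?num_real// -[k ^+ 2]real_normK ?num_real//.
  have := sqr_ge0 (`|h| - `|k|); have := sqr_ge0 `|h|; have := sqr_ge0 `|k|; nra.
apply: (le_trans (ler_normD _ _)); apply: (le_trans (lerD (ler_normD _ _) hk)).
move: T1 T2; set x := `|X|; set y := `|Y|; lra.
Qed.

End Taylor.

(** * From a nondegenerate Hessian to a quadratic gap on the whole disc *)

Section StrongConcavity.
Local Opaque partial.
Context {R : realType}.
Implicit Types (u w : R * R -> R) (p c x y : R * R) (U : set (R * R)).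

Lemma concave_onP w : concave_on unit_disc w <->
  forall x y (a : R), unit_disc x -> unit_disc y -> 0 <= a <= 1 ->
    a * w x + (1 - a) * w y <= w (a *: x + (1 - a) *: y).
Proof.
split=> [wC x y a Dx Dy /andP[a0 a1]|wC t x y].
  have := wC (Itv01 a0 a1) x y; rewrite !inE => /(_ Dx Dy).
  by rewrite convRE !mulrN -opprD lerN2.
rewrite !inE => Dx Dy; rewrite -lerN2 opprK.
apply: le_trans (wC x y t%:num Dx Dy _); last by apply/andP; split.
by rewrite convRE !mulrN -opprD opprK.
Qed.

Lemma unit_disc_convex x y (a : R) : unit_disc x -> unit_disc y -> 0 <= a <= 1 ->
  unit_disc (a *: x + (1 - a) *: y).
Proof.
rewrite /unit_disc/= /GRing.scale/= => Dx Dy /andP[a0 a1].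
have a1' : 0 <= 1 - a by rewrite subr_ge0.
have H (s t : R) : (a * s + (1 - a) * t) ^+ 2 <= a * s ^+ 2 + (1 - a) * t ^+ 2.
  rewrite -subr_ge0 (_ : _ - _ = a * (1 - a) * (s - t) ^+ 2); last by ring.
  by rewrite mulr_ge0 ?sqr_ge0// mulr_ge0.
apply: (le_trans (lerD (H _ _) (H _ _))).
by move: (ler_wpM2l a0 Dx) (ler_wpM2l a1' Dy); lra.
Qed.

Lemma unit_disc_le1 x : unit_disc x -> `|x.1| <= 1 /\ `|x.2| <= 1.
Proof.
rewrite /unit_disc/= => Dx; have := sqr_ge0 x.1; have := sqr_ge0 x.2 => x2 x1.
by split; rewrite -(@expr_le1 _ 2)// real_normK ?num_real//; lra.
Qed.

(** Cayley-Hamilton: if [S] is the symmetric matrix of the form [Q], then [(a + d) Q(v) - det S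
    |v|^2 = |S v|^2 >= 0], and division by the negative trace gives [m = det S / - (a + d)]. *)
Lemma le0_quad_form (a b d : R) : (forall h k, a * h ^+ 2 + 2 * b * h * k + d * k ^+ 2 <= 0) ->
  a * d - b ^+ 2 != 0 ->
  exists2 m, 0 < m & forall h k, a * h ^+ 2 + 2 * b * h * k + d * k ^+ 2 <= - m * (h ^+ 2 + k ^+ 2).
Proof.
move=> Q D0.
have := Q 1 0; have := Q 0 1; rewrite !expr0n/= !expr1n !mulr0 !mulr1 !addr0 !add0r => d0 a0.
have D : 0 < a * d - b ^+ 2.
  rewrite lt_neqAle eq_sym D0/=; rewrite leNgt; apply/negP => D.
  (* These vectors give the values [a det] and [d det]. A negative determinant thus forces
     [a = d = 0], and then [(1, 1)] and [(1, -1)] force [b = 0]. *)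
  have := Q b (- a); have := Q (- d) b => Q1 Q2.
  have a00 : a = 0 by apply/eqP; rewrite eq_le a0/=; nra.
  have d00 : d = 0 by apply/eqP; rewrite eq_le d0/=; nra.
  by have := Q 1 1; have := Q 1 (-1); move: D; rewrite a00 d00; nra.
have ad : a + d < 0 by nra.
exists ((a * d - b ^+ 2) / - (a + d)); first by rewrite divr_gt0// oppr_gt0.
move=> h k; rewrite -subr_ge0 -(pmulr_rge0 _ (_ : 0 < - (a + d))) ?oppr_gt0//.
rewrite (_ : - (a + d) * (_ - _) = (a * h + b * k) ^+ 2 + (b * h + d * k) ^+ 2).
  by rewrite addr_ge0 ?sqr_ge0.
by field; lra.
Qed.

Lemma dirvec_add c (h k : R) :
  (c.1 + h, c.2 + k) = c + h *: dirvec ord0 + k *: dirvec ord_max.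
Proof. by rewrite /dirvec; congr pair => /=; rewrite /GRing.scale/=; ring. Qed.

Lemma dirvec_decomp c x : x = c + (x.1 - c.1) *: dirvec ord0 + (x.2 - c.2) *: dirvec ord_max.
Proof. by rewrite -dirvec_add !subrKC -surjective_pairing. Qed.

Let scaled_le (e n : R) : 0 <= n -> 0 < e -> 2 * (e / (2 * (n + 1))) * n <= e.
Proof.
move=> n0 e0; have n1 : 0 < n + 1 by rewrite ltr_wpDl.
rewrite (_ : 2 * _ * n = e * (n / (n + 1))); first by rewrite ler_piMr ?(ltW e0)// ler_pdivrMr// mul1r lerDl.
by field; rewrite gt_eqF.
Qed.

Lemma det2 (A : 'M[R]_2) : \det A =
  A ord0 ord0 * A ord_max ord_max - A ord0 ord_max * A ord_max ord0.
Proof.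
rewrite (expand_det_row _ ord0) big_ord_recl big_ord1 /cofactor !det_mx11 !mxE/=.
have -> : lift ord0 ord0 = ord_max :> 'I_2 by exact/val_inj.
have -> : lift ord_max ord0 = ord0 :> 'I_2 by exact/val_inj.
by rewrite expr0 expr1 mul1r mulN1r mulrN.
Qed.

Section AtPoint.
Variables (u : R * R -> R) (U : set (R * R)) (p : R * R).
Hypotheses (uC : concave_on unit_disc u) (oU : open U) (Ud : U `<=` unit_disc).
Hypotheses (u2 : C2_on U u) (Up : U p).
Let a := partial ord0 (partial ord0 u) p.
Let b := partial ord_max (partial ord0 u) p.
Let d := partial ord_max (partial ord_max u) p.

(** The two orders of the axes expand the same increment [(r, r)]; the expansions differ only by the
    mixed terms, that is by [(b' - b) r^2]. *)
Lemma mixed_partials_eq : partial ord0 (partial ord_max u) p = b.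
Proof.
set b' := LHS; apply/eqP; rewrite -subr_eq0 -normr_eq0 eq_le normr_ge0 andbT.
apply/ler_addgt0Pr => e e0; rewrite add0r.
have e4 : 0 < e / 4 by rewrite divr_gt0.
have [r1 r10 T1] := C2_taylor ord0 ord_max oU u2 Up e4.
have [r2 r20 T2] := C2_taylor ord_max ord0 oU u2 Up e4.
pose r := Num.min r1 r2; have r0 : 0 < r by rewrite lt_min r10.
have pp s : 0 < s -> square p s p by move=> s0; split; rewrite subrr normr0 ltW.
have hr1 : `|r| <= r1 by rewrite gtr0_norm// ge_min lexx.
have hr2 : `|r| <= r2 by rewrite gtr0_norm// ge_min lexx orbT.
pose x := p + r *: dirvec ord0 + r *: dirvec ord_max.
have := T1 p x r r (pp _ r10) hr1 hr1 erefl.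
have := T2 p x r r (pp _ r20) hr2 hr2 (addrAC _ _ _).
rewrite /b' /b => {T1 T2}.
generalize (partial ord0 (partial ord0 u) p) (partial ord_max (partial ord_max u) p).
generalize (partial ord_max (partial ord0 u) p) (partial ord0 (partial ord_max u) p).
generalize (partial ord0 u p) (partial ord_max u p).
generalize (u x) (u p).
move=> F F0 gx gy b1 b2 a1 d1 B A.
have : `|(b2 - b1) * r ^+ 2| <= e * r ^+ 2.
  rewrite (_ : (b2 - b1) * r ^+ 2 = (F - F0 - r * gx - r * gy - (a1 * r ^+ 2 / 2 + b1 * r * r + d1 * r ^+ 2 / 2))
   - (F - F0 - r * gy - r * gx - (d1 * r ^+ 2 / 2 + b2 * r * r + a1 * r ^+ 2 / 2))).
    apply: (le_trans (ler_normB _ _)).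
    apply: (le_trans (lerD A B)); lra.
  by field.
by rewrite normrM (gtr0_norm (exprn_gt0 _ r0)) ler_pM2r// exprn_gt0.
Qed.

(** Midpoint concavity between [p + s (h, k)] and [p - s (h, k)] cancels the first-order terms and
    bounds [s^2] times the form by the Taylor error; [s] only brings the two points close enough to
    [p]. *)
Lemma hessian_form_le0 h k : a * h ^+ 2 + 2 * b * h * k + d * k ^+ 2 <= 0.
Proof.
apply/ler_addgt0Pr => e e0; rewrite add0r.
set n2 := h ^+ 2 + k ^+ 2.
have n20 : 0 <= n2 by rewrite addr_ge0 ?sqr_ge0.
have e1 : 0 < e / (2 * (n2 + 1)) by rewrite divr_gt0// mulr_gt0// ltr_wpDl.
have [r r0 T] := C2_taylor ord0 ord_max oU u2 Up e1.
have nearU : \near p, U p by exact: open_nbhs_nbhs.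
have /nbhs_squareP[r' r'0 rU] := nearU.
pose m := Num.min r r'; have m0 : 0 < m by rewrite lt_min r0.
pose s := m / (`|h| + `|k| + 1).
have N0 : 0 < `|h| + `|k| + 1 by rewrite ltr_wpDl// addr_ge0.
have s0 : 0 < s by rewrite divr_gt0.
have sm z : `|z| <= `|h| + `|k| + 1 -> `|s * z| <= m.
  move=> zN; rewrite normrM gtr0_norm// /s mulrAC ler_pdivrMr//.
  by rewrite ler_pM2l.
have sh : `|s * h| <= m by apply: sm; rewrite -addrA lerDl addr_ge0.
have sk : `|s * k| <= m by apply: sm; rewrite addrAC lerDr addr_ge0.
have mr : m <= r by rewrite ge_min lexx.
have mr' : m <= r' by rewrite ge_min lexx orbT.
have pp : square p r p by split; rewrite subrr normr0 ltW.
pose x := (p.1 + s * h, p.2 + s * k); pose y := (p.1 + - (s * h), p.2 + - (s * k)).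
have := T p x (s * h) (s * k) pp (le_trans sh mr) (le_trans sk mr) (dirvec_add _ _ _).
have := T p y (- (s * h)) (- (s * k)) pp; rewrite !normrN.
move=> /(_ (le_trans sh mr) (le_trans sk mr) (dirvec_add _ _ _)).
have Dx : unit_disc x.
  by apply/Ud/rU; split; rewrite /= addrC addKr; apply: le_trans mr'.
have Dy : unit_disc y.
  by apply/Ud/rU; split; rewrite /= addrC addKr normrN; apply: le_trans mr'.
have h01 : 0 <= (2^-1 : R) <= 1 by apply/andP; split; lra.
have := (concave_onP _).1 uC x y 2^-1 Dx Dy h01.
have -> : 2^-1 *: x + (1 - 2^-1) *: y = p.
  by rewrite [p in RHS]surjective_pairing; congr pair; rewrite /= /GRing.scale/=; field.
have : s ^+ 2 * (a * h ^+ 2 + 2 * b * h * k + d * k ^+ 2) <=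
    s ^+ 2 * (2 * (e / (2 * (n2 + 1))) * n2) -> a * h ^+ 2 + 2 * b * h * k + d * k ^+ 2 <= e.
  rewrite ler_pM2l ?exprn_gt0// => /le_trans; apply.
  exact: scaled_le.
rewrite /a /b /d /n2.
generalize (partial ord0 (partial ord0 u) p) (partial ord_max (partial ord_max u) p).
generalize (partial ord_max (partial ord0 u) p) (partial ord0 u p) (partial ord_max u p).
generalize (u x) (u y) (u p) (e / (2 * (h ^+ 2 + k ^+ 2 + 1))).
move=> F F' F0 q b1 gx gy a1 d1 goal C; rewrite !ler_norml => /andP[B _] /andP[A _].
apply: goal; lra.
Qed.

(** Near [c] the gap comes from the Taylor expansion; concavity along the segment from [c] carries
    it to distant [x], at the cost of a smaller constant. *)
Lemma strong_concavity : hessian u p \in unitmx ->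
  exists r k, [/\ 0 < r, 0 < k, square p r `<=` U &
  forall c x, square p r c -> unit_disc x ->
    u x <= u c + partial ord0 u c * (x.1 - c.1) + partial ord_max u c * (x.2 - c.2)
      - k * ((x.1 - c.1) ^+ 2 + (x.2 - c.2) ^+ 2)].
Proof.
rewrite unitmxE unitfE => H.
have [m m0 Qm] : exists2 m, 0 < m & forall h k, a * h ^+ 2 + 2 * b * h * k + d * k ^+ 2 <= - m * (h ^+ 2 + k ^+ 2).
  apply: le0_quad_form; first exact: hessian_form_le0.
  rewrite expr2; move: H; rewrite det2 [hessian u p ord0 ord0]mxE
    [hessian u p ord_max ord_max]mxE [hessian u p ord0 ord_max]mxE
    [hessian u p ord_max ord0]mxE.
  by have -> := mixed_partials_eq.
have m4 : 0 < m / 4 by rewrite divr_gt0.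
have [r1 r10 T] := C2_taylor ord0 ord_max oU u2 Up m4.
have nearU : \near p, U p by exact: open_nbhs_nbhs.
have /nbhs_squareP[r2 r20 rU] := nearU.
pose r := Num.min (Num.min r1 (r2 / 2)) 1.
have r0 : 0 < r by rewrite !lt_min r10 divr_gt0/=.
have rr1 : r <= r1 by rewrite !ge_min lexx.
have rr2 : r <= r2 / 2 by rewrite !ge_min lexx orbT.
have rr3 : r <= 1 by rewrite ge_min lexx orbT.
have local c x : square p r c -> square c r x ->
    u x <= u c + partial ord0 u c * (x.1 - c.1) + partial ord_max u c * (x.2 - c.2)
      - m / 4 * ((x.1 - c.1) ^+ 2 + (x.2 - c.2) ^+ 2).
  move=> pc [x1 x2].
  have := T c x _ _ (square_le rr1 pc) (le_trans x1 rr1) (le_trans x2 rr1) (dirvec_decomp c x).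
  rewrite -/a -/b -/d ler_norml => /andP[_].
  by have := Qm (x.1 - c.1) (x.2 - c.2); lra.
have sqU : square p r `<=` U.
  apply: subset_trans rU; apply: square_le; apply: (le_trans rr2).
  by rewrite ler_pdivrMr// ler_pMr// ler1n.
(* Taylor's one half turns [- m] into [- m / 2], and the error takes back [m / 4]; the factor
   [r / 2] pays for distant [x]. *)
exists r, (m / 4 * (r / 2)); split => //; first by rewrite mulr_gt0// divr_gt0.
move=> c x pc Dx.
have n0 : 0 <= (x.1 - c.1) ^+ 2 + (x.2 - c.2) ^+ 2 by rewrite addr_ge0 ?sqr_ge0.
have [cx|cx] := pselect (square c r x).
  apply: (le_trans (local _ _ pc cx)); rewrite lerD2l lerN2 ler_wpM2r//.
  by rewrite ler_piMr ?(ltW m4)// ler_pdivrMr// (le_trans rr3)// mul1r ler1n.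
pose n := Num.max `|x.1 - c.1| `|x.2 - c.2|.
have rn : r < n.
  rewrite ltNge; apply/negP => nr; apply: cx; split; apply: le_trans nr;
    by rewrite le_max lexx ?orbT.
have Dc : unit_disc c by exact/Ud/sqU.
have [x1 x2] := unit_disc_le1 Dx; have [c1 c2] := unit_disc_le1 Dc.
have n2 : n <= 2.
  by rewrite ge_max; apply/andP; split; apply: (le_trans (ler_normB _ _)); lra.
have n_gt0 : 0 < n by exact: lt_trans rn.
(* [z] is the point of the segment at sup-distance [r] from [c]. The increment of [u] to [x] is at
   most that to [z] divided by [s], which leaves a gap [s m / 4] times the squared distance;
   [s >= r / 2] because sup-distances in the disc are at most 2. *)
pose s := r / n.
have s0 : 0 < s by rewrite divr_gt0.
have s1 : s <= 1 by rewrite ler_pdivrMr// mul1r ltW.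
pose z := s *: x + (1 - s) *: c.
have z1 : z.1 - c.1 = s * (x.1 - c.1) by rewrite /= /GRing.scale/=; ring.
have z2 : z.2 - c.2 = s * (x.2 - c.2) by rewrite /= /GRing.scale/=; ring.
have cz : square c r z.
  split; rewrite ?z1 ?z2 normrM gtr0_norm// /s mulrAC ler_pdivrMr// ler_pM2l//;
    by rewrite le_max lexx ?orbT.
have s01 : 0 <= s <= 1 by rewrite (ltW s0).
have := le_trans ((concave_onP _).1 uC x c s Dx Dc s01) (local _ _ pc cz).
rewrite z1 z2 => L.
have rs : r / 2 <= s by rewrite ler_pM2l// lef_pV2 ?posrE.
set N := (x.1 - c.1) ^+ 2 + (x.2 - c.2) ^+ 2 in n0 *.
rewrite -(ler_pM2l s0).
have : s * (m / 4 * (r / 2) * N) <= m / 4 * s ^+ 2 * N.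
  rewrite -subr_ge0 (_ : _ - _ = m / 4 * s * N * (s - r / 2)); last by ring.
  have [s0' m4'] := (ltW s0, ltW m4).
  apply: mulr_ge0; last by rewrite subr_ge0.
  apply: mulr_ge0 => //.
  exact: mulr_ge0.
move: L; rewrite !exprMn -mulrDr -/N.
generalize (partial ord0 u c) (partial ord_max u c) (u x) (u c) N.
move=> gx gy ux uc {n0}N L L'; lra.
Qed.
End AtPoint.
End StrongConcavity.

(** * Calculus of C^{1,1} functions on the disc *)

Section C11.
Context {R : realType}.
Implicit Types (f g : R * R -> R) (x c : R * R).

(* [(f1, f2)] is the gradient of [f]; the last bound amounts to its being
   Lipschitz and is stable under products. *)
Definition C11_bound (C : R) f f1 f2 := forall c, unit_disc c ->
  [/\ `|f c| <= C, `|f1 c| <= C, `|f2 c| <= C &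
   forall x, unit_disc x ->
   `|f x - f c - f1 c * (x.1 - c.1) - f2 c * (x.2 - c.2)|
     <= C * ((x.1 - c.1) ^+ 2 + (x.2 - c.2) ^+ 2)].

Definition C11 f f1 f2 := exists C, C11_bound C f f1 f2.

Lemma C11_bound_ge0 C f f1 f2 : C11_bound C f f1 f2 -> 0 <= C.
Proof.
have D0 : unit_disc ((0, 0) : R * R) by rewrite /unit_disc/= expr0n addr0 ler01.
by move=> /(_ _ D0)[/(le_trans (normr_ge0 _))].
Qed.

Lemma C11_bound_le C C' f f1 f2 : C <= C' -> C11_bound C f f1 f2 -> C11_bound C' f f1 f2.
Proof.
move=> CC' fC c /fC[f0 h1 h2 fx]; split; do ?exact: le_trans CC'.
move=> x /fx /le_trans; apply; rewrite ler_wpM2r// addr_ge0 ?sqr_ge0//.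
Qed.

(** Coordinates of two points of the disc differ by at most 2, so the quadratic remainder is also
    linear in the increment. The constant 50 is generous. *)
Let C11_lip C f f1 f2 x c : C11_bound C f f1 f2 -> unit_disc x -> unit_disc c ->
  (f x - f c) ^+ 2 <= 50 * C ^+ 2 * ((x.1 - c.1) ^+ 2 + (x.2 - c.2) ^+ 2).
Proof.
move=> fC Dx Dc; have C0 := C11_bound_ge0 fC; have [_ g1 g2 /(_ _ Dx)] := fC c Dc.
have [x1 x2] := unit_disc_le1 Dx; have [c1 c2] := unit_disc_le1 Dc.
have v1 : `|x.1 - c.1| <= 2 by apply: (le_trans (ler_normB _ _)); lra.
have v2 : `|x.2 - c.2| <= 2 by apply: (le_trans (ler_normB _ _)); lra.
move: v1 v2 g1 g2 {x1 x2 c1 c2}.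
rewrite -(real_normK (num_real (x.1 - c.1))) -(real_normK (num_real (x.2 - c.2))).
rewrite -(real_normK (num_real (f x - f c))).
move: (x.1 - c.1) (x.2 - c.2) (f x - f c) (f1 c) (f2 c) => a b F g1 g2 a2 b2 g1C g2C FC.
have : `|F| <= 3 * C * `|a| + 3 * C * `|b|.
  have -> : F = (F - g1 * a - g2 * b) + g1 * a + g2 * b by ring.
  apply: (le_trans (ler_normD _ _)); rewrite normrM.
  apply: (le_trans (lerD (ler_normD _ _) (lexx _))); rewrite normrM.
  have A : `|g1| * `|a| <= C * `|a| by rewrite ler_wpM2r.
  have B : `|g2| * `|b| <= C * `|b| by rewrite ler_wpM2r.
  have A2 : C * `|a| ^+ 2 <= C * (2 * `|a|) by rewrite ler_wpM2l// expr2 ler_wpM2r.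
  have B2 : C * `|b| ^+ 2 <= C * (2 * `|b|) by rewrite ler_wpM2l// expr2 ler_wpM2r.
  by move: FC A B A2 B2; lra.
move=> {a2 b2 g1C g2C FC}; move: (normr_ge0 F) (normr_ge0 a) (normr_ge0 b).
move: (`|F|) (`|a|) (`|b|) => {}F {}a {}b F0 a0 b0 H.
apply: (@le_trans _ _ ((3 * C * a + 3 * C * b) ^+ 2)).
  by rewrite ler_pXn2r// nnegrE// addr_ge0// !mulr_ge0.
rewrite -subr_ge0 (_ : _ - _ = C ^+ 2 * (9 * (a - b) ^+ 2 + 32 * a ^+ 2 + 32 * b ^+ 2)); last by ring.
rewrite mulr_ge0 ?sqr_ge0// !addr_ge0// mulr_ge0 ?sqr_ge0//.
Qed.

(** The remainder of the product is [g c] times that of [f], plus [f c] times that of [g], plus the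
    product of the two increments, which is quadratic by the Lipschitz bound: [1 + 1 + 50 <= 60]. *)
Lemma C11M f f1 f2 g g1 g2 : C11 f f1 f2 -> C11 g g1 g2 ->
  C11 (f \* g) (fun x => f1 x * g x + f x * g1 x) (fun x => f2 x * g x + f x * g2 x).
Proof.
move=> [C1 fC1] [C2 gC2]; pose C := Num.max C1 C2.
have fC : C11_bound C f f1 f2 by apply: C11_bound_le fC1; rewrite le_max lexx.
have gC : C11_bound C g g1 g2 by apply: C11_bound_le gC2; rewrite le_max lexx orbT.
have C0 := C11_bound_ge0 fC; exists (60 * C ^+ 2) => c Dc.
have [fc f1c f2c fx] := fC c Dc; have [gc g1c g2c gx] := gC c Dc.
have M (a b : R) : `|a| <= C -> `|b| <= C -> `|a * b| <= C ^+ 2.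
  by move=> aC bC; rewrite normrM expr2 ler_pM.
have C20 : 0 <= C ^+ 2 by exact: sqr_ge0.
split.
- by apply: (le_trans (M _ _ fc gc)); lra.
- by apply: (le_trans (ler_normD _ _)); apply: (le_trans (lerD (M _ _ f1c gc) (M _ _ fc g1c))); lra.
- by apply: (le_trans (ler_normD _ _)); apply: (le_trans (lerD (M _ _ f2c gc) (M _ _ fc g2c))); lra.
move=> x Dx; have := fx x Dx; have := gx x Dx.
have := C11_lip fC Dx Dc; have := C11_lip gC Dx Dc => /=.
move: {M fx gx} fc f1c f2c gc g1c g2c.
move: (x.1 - c.1) (x.2 - c.2) (f x) (f c) (f1 c) (f2 c) (g x) (g c) (g1 c) (g2 c).
move=> a b F fc f1c f2c G gc g1c g2c hf _ _ hg _ _ gl fl gq fq.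
set N := a ^+ 2 + b ^+ 2 in gl fl gq fq *.
have N0 : 0 <= N by rewrite addr_ge0 ?sqr_ge0.
have -> : F * G - fc * gc - (f1c * gc + fc * g1c) * a - (f2c * gc + fc * g2c) * b =
   gc * (F - fc - f1c * a - f2c * b) + fc * (G - gc - g1c * a - g2c * b) +
   (F - fc) * (G - gc) by ring.
have P1 : `|gc * (F - fc - f1c * a - f2c * b)| <= C * (C * N) by rewrite normrM ler_pM.
have P2 : `|fc * (G - gc - g1c * a - g2c * b)| <= C * (C * N) by rewrite normrM ler_pM.
have P3 : `|(F - fc) * (G - gc)| <= ((F - fc) ^+ 2 + (G - gc) ^+ 2) / 2.
  rewrite normrM -(real_normK (num_real (F - fc))) -(real_normK (num_real (G - gc))).
  move: (`|F - fc|) (`|G - gc|) => s t.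
  by have := sqr_ge0 (s - t); rewrite sqrrB mulr2n; lra.
apply: (le_trans (ler_normD _ _)); apply: (le_trans (lerD (ler_normD _ _) P3)).
apply: (le_trans (lerD (lerD P1 P2) (lexx _))).
have : 0 <= C ^+ 2 * N by rewrite mulr_ge0.
by move: gl fl; rewrite expr2; lra.
Qed.

(** [B] bounds the affine map on the disc, so [g] has to be controlled on [[-B, B]] only; this
    matters for [pospart2], whose derivative is unbounded on the line. *)
Lemma C11_linear (g dg : R -> R) (a b d : R) (B : R) :
  `|a| + `|b| + `|d| <= B ->
  (exists C, forall s, `|s| <= B -> [/\ `|g s| <= C, `|dg s| <= C &
    forall t, `|t| <= B -> `|g t - g s - dg s * (t - s)| <= C * (t - s) ^+ 2]) ->
  C11 (fun x => g (a * x.1 + b * x.2 + d)) (fun x => a * dg (a * x.1 + b * x.2 + d))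
      (fun x => b * dg (a * x.1 + b * x.2 + d)).
Proof.
move=> aB [C gC].
have inB x : unit_disc x -> `|a * x.1 + b * x.2 + d| <= B.
  move=> /unit_disc_le1[x1 x2]; apply: le_trans aB.
  apply: (le_trans (ler_normD _ _)); rewrite lerD2r.
  apply: (le_trans (ler_normD _ _)); rewrite !normrM.
  by apply: lerD; rewrite ler_piMr.
have C0 : 0 <= C.
  have B0 : 0 <= B by apply: le_trans aB; rewrite !addr_ge0.
  by have [|/(le_trans (normr_ge0 _))] := gC 0; rewrite ?normr0.
pose S := (1 + `|a| + `|b| + a ^+ 2 + b ^+ 2).
have a0 := normr_ge0 a; have b0 := normr_ge0 b; have a20 := sqr_ge0 a; have b20 := sqr_ge0 b.
have S1 : C <= S * C by rewrite ler_peMl// /S; lra.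
exists (S * C) => c Dc; have [gs dgs gq] := gC _ (inB c Dc); split.
- exact: le_trans S1.
- by rewrite normrM ler_pM// /S; lra.
- by rewrite normrM ler_pM// /S; lra.
move=> x Dx; have := gq _ (inB x Dx).
set s := a * c.1 + _ + _; set t := a * x.1 + _ + _.
have ts : t - s = a * (x.1 - c.1) + b * (x.2 - c.2) by rewrite /t /s; ring.
have -> : g t - g s - a * dg s * (x.1 - c.1) - b * dg s * (x.2 - c.2) =
  g t - g s - dg s * (t - s) by rewrite ts; ring.
move=> /le_trans; apply; rewrite ts (mulrC S) -mulrA ler_wpM2l//.
move: (x.1 - c.1) (x.2 - c.2) => v w.
have := sqr_ge0 (a * w - b * v); have := sqr_ge0 v; have := sqr_ge0 w => w0 v0 ab.
have : 0 <= (1 + `|a| + `|b|) * (v ^+ 2 + w ^+ 2) by rewrite mulr_ge0 ?addr_ge0.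
by rewrite /S; move: ab; lra.
Qed.

Let shift_is_derive (g : R -> R) (s x dg : R) : is_derive (x + s) 1 g dg ->
  is_derive x 1 (fun x : R => g (x + s)) dg.
Proof.
move=> dgx; rewrite -[dg]mulr1; apply: (@is_derive1_comp R g (fun x : R => x + s)).
by apply: is_derive_eq; rewrite addr0.
Qed.

Let taylor2_line (g g1 g2 : R -> R) (s t : R) :
  (forall x : R, is_derive x 1 g (g1 x)) -> (forall x : R, is_derive x 1 g1 (g2 x)) ->
  (forall x : R, `|g2 x| <= 1) -> `|g t - g s - g1 s * (t - s)| <= (t - s) ^+ 2.
Proof.
move=> dg dg1 g2le.
have := @taylor2_bound R (fun x : R => g (x + s)) (fun x : R => g1 (x + s)) (fun x : R => g2 (x + s))
  (t - s) 0 1.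
rewrite add0r subrK !mul0r subr0 mul1r (mulrC (g1 s)); apply => a _.
- exact: shift_is_derive.
- exact: shift_is_derive.
- by rewrite subr0.
Qed.

Lemma sin_taylor_bound (B s : R) : `|s| <= B -> [/\ `|sin s| <= 1, `|cos s| <= 1 &
  forall t, `|t| <= B -> `|sin t - sin s - cos s * (t - s)| <= 1 * (t - s) ^+ 2].
Proof.
move=> _; split=> [||t _]; [exact: sin_max|exact: cos_max|rewrite mul1r].
apply: (@taylor2_line sin cos (fun x : R => - sin x)) => x; last by rewrite normrN sin_max.
Qed.

Lemma cos_taylor_bound (B s : R) : `|s| <= B -> [/\ `|cos s| <= 1, `|- sin s| <= 1 &
  forall t, `|t| <= B -> `|cos t - cos s - - sin s * (t - s)| <= 1 * (t - s) ^+ 2].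
Proof.
move=> _; split=> [||t _]; [exact: cos_max|by rewrite normrN sin_max|rewrite mul1r].
apply: (@taylor2_line cos (fun x : R => - sin x) (fun x : R => - cos x)) => x.
by rewrite normrN cos_max.
Qed.

(** The one-variable building block of the bump: C^{1,1}, zero on a half-line, with derivative
    [2 * Num.max x 0]. *)
Definition pospart2 (x : R) : R := Num.max x 0 ^+ 2.

Lemma pospart2_bound (B : R) : exists C, forall s, `|s| <= B -> [/\ `|pospart2 s| <= C, `|2 * Num.max s 0| <= C &
    forall t, `|t| <= B -> `|pospart2 t - pospart2 s - 2 * Num.max s 0 * (t - s)| <= C * (t - s) ^+ 2].
Proof.
exists (1 + 2 * `|B| + B ^+ 2) => s sB.
have B0 : 0 <= B by exact: le_trans sB.
rewrite (ger0_norm B0); have B2 := sqr_ge0 B.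
have mB : Num.max s 0 <= B by rewrite ge_max B0 andbT (le_trans (ler_norm _)).
have m0 : 0 <= Num.max s 0 by rewrite le_max lexx orbT.
split.
- rewrite /pospart2 ger0_norm ?sqr_ge0//; apply: (@le_trans _ _ (B ^+ 2)); last by lra.
  by rewrite ler_pXn2r.
- by rewrite ger0_norm ?mulr_ge0//; lra.
move=> t tB; apply: (@le_trans _ _ ((t - s) ^+ 2)); last first.
  by rewrite ler_peMl ?sqr_ge0//; lra.
rewrite /pospart2 ler_norml; apply/andP.
have := sqr_ge0 t; have := sqr_ge0 s; have := sqr_ge0 (t - s).
have st : (s <= 0 /\ 0 < t) \/ (0 < s /\ t <= 0) -> s * t <= 0 by nra.
case: (leP s 0) st => s0; case: (leP t 0) => t0 st; rewrite ?expr0n/= => ? ? ?;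
  have {}st := st; do ?[have {}st : s * t <= 0 by apply: st; tauto]; split; lra.
Qed.

End C11.

(** * Concavity of the perturbed function on the whole disc *)

Section Perturbation.
Context {R : realType}.
Implicit Types (f u : R * R -> R) (x c p : R * R).

Lemma is_derive_quadratic_error f p v (l C : R) :
  (\forall h \near (0 : R), `|f (p + h *: v) - f p - h * l| <= C * h ^+ 2) ->
  is_derive p v f l.
Proof.
move=> fl.
suff H : h^-1 *: ((f \o shift p) (h *: v) - f p) @[h --> 0^'] --> l.
  by split; [apply/cvg_ex; exists l|exact/cvg_lim].
apply/cvgrPdist_le => e e0.
pose d := e / (`|C| + 1).
have C1 : 0 < `|C| + 1 by rewrite ltr_wpDl.
have d0 : 0 < d by rewrite divr_gt0.
near=> h.
have h0 : h != 0 by near: h; exact: nbhs_dnbhs_neq.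
have hd : `|h| <= d by near: h; apply: dnbhs0_le.
have : `|f (p + h *: v) - f p - h * l| <= C * h ^+ 2 by near: h; exact: nbhs_dnbhs.
rewrite /= (addrC (h *: v)); move: (f (p + h *: v)) (f p) => F F0 FF.
have -> : l - h^-1 *: (F - F0) = - (h^-1 * (F - F0 - h * l)).
  by rewrite /GRing.scale/=; field.
rewrite normrN normrM normfV ler_pdivrMl ?normr_gt0//.
apply: (le_trans FF); rewrite -real_normK ?num_real// expr2 mulrA mulrC.
rewrite ler_wpM2l//; apply: (@le_trans _ _ (`|C| * d)).
  apply: (@le_trans _ _ (`|C| * `|h|)); first by rewrite ler_wpM2r// ler_norm.
  by rewrite ler_wpM2l.
by rewrite /d mulrCA ler_piMr ?(ltW e0)// ler_pdivrMr// mul1r lerDl.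
Unshelve. all: by end_near. Qed.

Lemma C11_is_derive f f1 f2 p : C11 f f1 f2 -> nbhs p unit_disc ->
  is_derive p (dirvec ord0) f (f1 p) /\ is_derive p (dirvec ord_max) f (f2 p).
Proof.
move=> [C fC] /nbhs_squareP[r r0 rD].
have Dp : unit_disc p by apply: rD; split; rewrite subrr normr0 ltW.
have [_ _ _ fp] := fC p Dp.
have near_small : \forall h \near (0 : R), `|h| <= r by exact: nbhs0_le.
have sm i h : `|h| <= r -> unit_disc (p + h *: dirvec i).
  move=> hr; apply: rD; rewrite -[r]add0r; apply: square_dirvec => //.
  by split; rewrite subrr normr0.
split; apply: (@is_derive_quadratic_error _ _ _ _ C); near=> h;
  have hr : `|h| <= r by near: h.
- have := fp _ (sm ord0 h hr).
  have -> : (p + h *: dirvec ord0).1 - p.1 = h by rewrite /= /GRing.scale/=; ring.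
  have -> : (p + h *: dirvec ord0).2 - p.2 = 0 by rewrite /= /GRing.scale/=; ring.
  by rewrite mulr0 subr0 expr0n addr0 (mulrC (f1 p)).
- have := fp _ (sm ord_max h hr).
  have -> : (p + h *: dirvec ord_max).1 - p.1 = 0 by rewrite /= /GRing.scale/=; ring.
  have -> : (p + h *: dirvec ord_max).2 - p.2 = h by rewrite /= /GRing.scale/=; ring.
  by rewrite mulr0 subr0 expr0n add0r (mulrC (f2 p)).
Unshelve. all: by end_near. Qed.

Section Concave.
Variables (u phi phi1 phi2 u1 u2 : R * R -> R) (p : R * R) (r k C t : R).
Hypotheses (uC : concave_on unit_disc u) (r0 : 0 < r).
Hypothesis rD : square p (3 * r) `<=` unit_disc.
Hypothesis u_strong : forall c x, square p (3 * r) c -> unit_disc x ->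
  u x <= u c + u1 c * (x.1 - c.1) + u2 c * (x.2 - c.2)
    - k * ((x.1 - c.1) ^+ 2 + (x.2 - c.2) ^+ 2).
Hypothesis phiC : C11_bound C phi phi1 phi2.
Hypothesis phi0 : forall x, r <= `|x.1 - p.1| \/ r <= `|x.2 - p.2| -> phi x = 0.
Hypothesis tk : `|t| * C <= k.
Let w x := u x + t * phi x.

(** Since [|t| C <= k], the quadratic gap of [u] absorbs the Taylor remainder of [t phi]. *)
Let w_supergradient c x : square p (3 * r) c -> unit_disc x ->
  w x <= w c + (u1 c + t * phi1 c) * (x.1 - c.1) + (u2 c + t * phi2 c) * (x.2 - c.2).
Proof.
move=> pc Dx; have := u_strong pc Dx.
have [_ _ _ /(_ x Dx) phix] := phiC (rD pc).
have : t * (phi x - phi c - phi1 c * (x.1 - c.1) - phi2 c * (x.2 - c.2)) <=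
    k * ((x.1 - c.1) ^+ 2 + (x.2 - c.2) ^+ 2).
  apply: (le_trans (ler_norm _)); rewrite normrM.
  apply: (le_trans (ler_wpM2l (normr_ge0 t) phix)).
  by rewrite mulrA ler_wpM2r// addr_ge0 ?sqr_ge0.
by rewrite /w; lra.
Qed.

Let w_middle x y (a : R) : unit_disc x -> unit_disc y -> 0 <= a <= 1 ->
  square p (3 * r) (a *: x + (1 - a) *: y) ->
  a * w x + (1 - a) * w y <= w (a *: x + (1 - a) *: y).
Proof.
move=> Dx Dy /andP[a0 a1] pz; set z := _ + _ in pz *.
have A := ler_wpM2l a0 (w_supergradient pz Dx).
have a1' : 0 <= 1 - a by rewrite subr_ge0.
have B := ler_wpM2l a1' (w_supergradient pz Dy).
apply: (le_trans (lerD A B)); rewrite le_eqVlt; apply/orP; left; apply/eqP.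
have z1 : z.1 = a * x.1 + (1 - a) * y.1 by [].
have z2 : z.2 = a * x.2 + (1 - a) * y.2 by [].
rewrite z1 z2; move: (w z) (u1 z + _) (u2 z + _) => W g1 g2; ring.
Qed.

Let out x : ~ square p r x -> phi x = 0.
Proof.
move=> px; apply: phi0; have [x1|x1] := leP r `|x.1 - p.1|; first by left.
by right; rewrite leNgt; apply/negP => x2; apply: px; split; apply: ltW.
Qed.

Let r_le3r : r <= 3 * r. Proof. by move: r0; lra. Qed.

(** The point [q] of the segment at sup-distance [2 r] from [x] lies in the square of radius [3 r],
    yet [phi] vanishes there. Concavity of [w] at [q], between [z] and [x], and of [u] at [z],
    between [q] and [y], combine by eliminating the value at [q]. *)
Let w_glue x y (a : R) : unit_disc x -> unit_disc y -> 0 <= a <= 1 ->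
  square p r x -> ~ square p r y -> ~ square p (3 * r) (a *: x + (1 - a) *: y) ->
  a * w x + (1 - a) * w y <= w (a *: x + (1 - a) *: y).
Proof.
move=> Dx Dy a01 px py; set z := _ + _ => pz; have /andP[a0 a1] := a01.
have Dz : unit_disc z by exact: unit_disc_convex.
have [px1 px2] := px.
pose m := Num.max `|z.1 - x.1| `|z.2 - x.2|.
have rm : 2 * r < m.
  rewrite ltNge; apply/negP => mr; apply: pz.
  have zx : square x (2 * r) z.
    by split; apply: le_trans mr; rewrite le_max lexx ?orbT.
  by have -> : 3 * r = r + 2 * r; [by ring|exact: square_sub px _ zx].
have m0 : 0 < m by apply: lt_trans rm; rewrite mulr_gt0.
pose s := 2 * r / m.
have s0 : 0 < s by rewrite divr_gt0// mulr_gt0.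
have s1 : s < 1 by rewrite ltr_pdivrMr// mul1r.
have s01 : 0 <= s <= 1 by rewrite !ltW.
pose q := s *: z + (1 - s) *: x.
have q1 : q.1 - x.1 = s * (z.1 - x.1) by rewrite /= /GRing.scale/=; ring.
have q2 : q.2 - x.2 = s * (z.2 - x.2) by rewrite /= /GRing.scale/=; ring.
have Dq : unit_disc q by exact: unit_disc_convex.
have sm : s * m = 2 * r by rewrite /s divfK// gt_eqF.
have pq : square p (3 * r) q.
  have -> : 3 * r = r + 2 * r by ring.
  apply: (square_sub px); split; rewrite ?q1 ?q2 normrM gtr0_norm// -sm ler_pM2l//;
    by rewrite le_max lexx ?orbT.
have phiq : phi q = 0.
  apply: phi0; have far (A B D : R) : `|A - B| = 2 * r -> `|B - D| <= r -> r <= `|A - D|.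
    move=> AB BD; have := ler_distD B A D; have := ler_normB (A - D) (B - D).
    by rewrite opprB subrKA AB; lra.
  have [mE|mE] : m = `|z.1 - x.1| \/ m = `|z.2 - x.2|.
    by rewrite /m; case: leP => _; [right|left].
  - by left; apply: far px1; rewrite q1 normrM gtr0_norm// -mE.
  - by right; apply: far px2; rewrite q2 normrM gtr0_norm// -mE.
have pz' : ~ square p r z by move=> /(square_le r_le3r).
have W1 := w_middle Dz Dx s01 pq.
(* The weight of [q] when [z] is written in terms of [q] and [y], obtained by eliminating [x] from
   the formulas for [q] and [z]. *)
pose b := a / (1 - s + a * s).
have den : 0 < 1 - s + a * s by rewrite ltr_wpDr ?subr_gt0// mulr_ge0// ltW.
have b01 : 0 <= b <= 1.
  rewrite divr_ge0 ?(ltW den)//= ler_pdivrMr// mul1r.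
  by rewrite -subr_ge0 (_ : _ - _ = (1 - s) * (1 - a)); [rewrite mulr_ge0 ?subr_ge0// ltW|ring].
have := (concave_onP _).1 uC q y b Dq Dy b01.
have -> : b *: q + (1 - b) *: y = z.
  rewrite [z in RHS]surjective_pairing; congr pair; rewrite /= /GRing.scale/= /b;
    by field; rewrite gt_eqF.
move: W1; rewrite -/q /w phiq (out py) (out pz') !mulr0 !addr0.
move: (u x + t * phi x) (u y) (u z) (u q) => wx wy wz wq W1.
rewrite -(ler_pM2l den).
have -> : (1 - s + a * s) * (b * wq + (1 - b) * wy) = a * wq + (1 - s) * (1 - a) * wy.
  by rewrite /b; field; rewrite gt_eqF.
move=> W2; have s1' : 0 < 1 - s by rewrite subr_gt0.
rewrite -(ler_pM2l s1').
by have := ler_wpM2l a0 W1; move: W2; lra.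
Qed.

Lemma perturbation_concave : concave_on unit_disc w.
Proof.
apply/concave_onP => x y a Dx Dy a01; have /andP[a0 a1] := a01.
have [pz|pz] := pselect (square p (3 * r) (a *: x + (1 - a) *: y)).
  exact: w_middle.
have pz' : ~ square p r (a *: x + (1 - a) *: y).
  by move=> /(square_le r_le3r).
have [px|px] := pselect (square p r x); have [py|py] := pselect (square p r y).
- exfalso; apply: pz'; have [x1 x2] := px; have [y1 y2] := py.
  have C2 (A B D : R) : `|A - D| <= r -> `|B - D| <= r -> `|a * A + (1 - a) * B - D| <= r.
    by rewrite !ler_norml => /andP[? ?] /andP[? ?]; apply/andP; split; nra.
  by split; apply: C2.
- exact: w_glue.
- have E : (1 - a) *: y + (1 - (1 - a)) *: x = a *: x + (1 - a) *: y.
    by rewrite subKr addrC.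
  rewrite -E in pz *; have := w_glue Dy Dx _ py px pz.
  by rewrite subKr (addrC (a * _)); apply; apply/andP; split; lra.
- by rewrite /w !out// !mulr0 !addr0; apply: (concave_onP _).1.
Qed.
End Concave.
End Perturbation.

(** * Second differences of the resistance density *)

Section SecondVariation.
Context {R : realType}.
Implicit Types A N t c s : R.

Definition density (x1 x2 : R) : R := (1 + (x1 ^+ 2 + x2 ^+ 2))^-1.

(** The infinitesimal coefficients are 8 and 2; doubling the first and halving the second makes room
    for finite steps of squared length at most [1 / 8]. *)
Lemma second_difference_le (x1 x2 y1 y2 : R) (A := 1 + (x1 ^+ 2 + x2 ^+ 2)) :
  y1 ^+ 2 + y2 ^+ 2 <= 1 / 8 ->
  density (x1 + y1) (x2 + y2) + density (x1 - y1) (x2 - y2) <=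
  2 * density x1 x2 + 16 * (x1 * y1 + x2 * y2) ^+ 2 / A ^+ 3
    - (y1 ^+ 2 + y2 ^+ 2) / A ^+ 2.
Proof.
set e := y1 ^+ 2 + y2 ^+ 2; set d := x1 * y1 + x2 * y2 => e8.
have A1 : 1 <= A by rewrite lerDl addr_ge0 ?sqr_ge0.
have e0 : 0 <= e by rewrite addr_ge0 ?sqr_ge0.
have dA : d ^+ 2 <= A * e.
  rewrite -subr_ge0 (_ : _ - _ = e + (x1 * y2 - x2 * y1) ^+ 2).
    by rewrite addr_ge0 ?sqr_ge0.
  by rewrite /A /e /d; ring.
have P0 : 0 < A + e + 2 * d.
  rewrite (_ : _ + _ = 1 + ((x1 + y1) ^+ 2 + (x2 + y2) ^+ 2)); last by rewrite /A /e /d; ring.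
  by rewrite ltr_pwDl// addr_ge0 ?sqr_ge0.
have M0 : 0 < A + e - 2 * d.
  rewrite (_ : _ - _ = 1 + ((x1 - y1) ^+ 2 + (x2 - y2) ^+ 2)); last by rewrite /A /e /d; ring.
  by rewrite ltr_pwDl// addr_ge0 ?sqr_ge0.
rewrite /density -/A.
have -> : 1 + ((x1 + y1) ^+ 2 + (x2 + y2) ^+ 2) = A + e + 2 * d by rewrite /A /e /d; ring.
have -> : 1 + ((x1 - y1) ^+ 2 + (x2 - y2) ^+ 2) = A + e - 2 * d by rewrite /A /e /d; ring.
move: A e d A1 e0 e8 dA P0 M0 => A e d A1 e0 e8 dA P0 M0.
have A0 : 0 < A by apply: lt_le_trans A1.
(* The product of the two denominators. It lies between [A^2 / 2] and [2 A^2], which makes every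
   term of the numerator displayed below nonnegative. *)
pose D := (A + e) ^+ 2 - 4 * d ^+ 2.
have DE : D = (A + e + 2 * d) * (A + e - 2 * d) by rewrite /D; ring.
have D0 : 0 < D by rewrite DE mulr_gt0.
have D1 : A ^+ 2 / 2 <= D by rewrite /D; nra.
have D2 : D <= 2 * A ^+ 2 by rewrite /D; nra.
have -> : (A + e + 2 * d)^-1 + (A + e - 2 * d)^-1 = 2 * (A + e) / D.
  by rewrite DE; field; rewrite !gt_eqF.
rewrite -subr_ge0.
have -> : 2 * A^-1 + 16 * d ^+ 2 / A ^+ 3 - e / A ^+ 2 - 2 * (A + e) / D =
    (16 * d ^+ 2 * (D - A ^+ 2 / 2) + e * A * (2 * A ^+ 2 - D) + 2 * e ^+ 2 * A ^+ 2) / (A ^+ 3 * D).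
  by move: D0; rewrite /D => D0; field; rewrite !gt_eqF.
have N1 : 0 <= 16 * d ^+ 2 * (D - A ^+ 2 / 2).
  by apply: mulr_ge0; [apply: mulr_ge0 => //; exact: sqr_ge0|rewrite subr_ge0].
have N2 : 0 <= e * A * (2 * A ^+ 2 - D).
  by apply: mulr_ge0; [apply: mulr_ge0 => //; exact: ltW|rewrite subr_ge0].
have N3 : 0 <= 2 * e ^+ 2 * A ^+ 2.
  by apply: mulr_ge0; [apply: mulr_ge0 => //; exact: sqr_ge0|exact: sqr_ge0].
apply: divr_ge0; first by rewrite !addr_ge0.
by apply/ltW/mulr_gt0 => //; exact: exprn_gt0.
Qed.

(* [h * c] and [h * s] stand for a bump times the cosine and the sine of a phase
   with gradient [(N * a, N * b)]; their second differences are added. *)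
Lemma oscillating_variation_le (x1 x2 a b h h1 h2 N t c s : R)
    (A := 1 + (x1 ^+ 2 + x2 ^+ 2))
    (yc1 := t * (h1 * c - N * a * (h * s))) (yc2 := t * (h2 * c - N * b * (h * s)))
    (ys1 := t * (h1 * s + N * a * (h * c))) (ys2 := t * (h2 * s + N * b * (h * c))) :
  c ^+ 2 + s ^+ 2 = 1 -> a ^+ 2 + b ^+ 2 = 1 -> (x1 * a + x2 * b) ^+ 2 <= 1 / 32 ->
  yc1 ^+ 2 + yc2 ^+ 2 <= 1 / 8 -> ys1 ^+ 2 + ys2 ^+ 2 <= 1 / 8 ->
  density (x1 + yc1) (x2 + yc2) + density (x1 - yc1) (x2 - yc2) +
  (density (x1 + ys1) (x2 + ys2) + density (x1 - ys1) (x2 - ys2)) <=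
  4 * density x1 x2 +
    t ^+ 2 * (16 * (h1 ^+ 2 + h2 ^+ 2) - N ^+ 2 * h ^+ 2 / (2 * A ^+ 2)).
Proof.
move=> cs ab xt /(second_difference_le x1 x2) Hc /(second_difference_le x1 x2) Hs.
apply: (le_trans (lerD Hc Hs)); rewrite -/A.
have A1 : 1 <= A by rewrite lerDl addr_ge0 ?sqr_ge0.
have A0 : 0 < A by apply: lt_le_trans A1.
have Ed : (x1 * yc1 + x2 * yc2) ^+ 2 + (x1 * ys1 + x2 * ys2) ^+ 2 =
   t ^+ 2 * ((x1 * h1 + x2 * h2) ^+ 2 + N ^+ 2 * h ^+ 2 * (x1 * a + x2 * b) ^+ 2).
  transitivity (t ^+ 2 * ((x1 * h1 + x2 * h2) ^+ 2 + N ^+ 2 * h ^+ 2 * (x1 * a + x2 * b) ^+ 2)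
    * (c ^+ 2 + s ^+ 2)); last by rewrite cs mulr1.
  by rewrite /yc1 /yc2 /ys1 /ys2; ring.
have Ee : yc1 ^+ 2 + yc2 ^+ 2 + (ys1 ^+ 2 + ys2 ^+ 2) =
   t ^+ 2 * (h1 ^+ 2 + h2 ^+ 2 + N ^+ 2 * h ^+ 2).
  transitivity (t ^+ 2 * (h1 ^+ 2 + h2 ^+ 2 + N ^+ 2 * h ^+ 2 * (a ^+ 2 + b ^+ 2))
    * (c ^+ 2 + s ^+ 2)); last by rewrite cs ab !mulr1.
  by rewrite /yc1 /yc2 /ys1 /ys2; ring.
have xh : (x1 * h1 + x2 * h2) ^+ 2 <= A * (h1 ^+ 2 + h2 ^+ 2).
  rewrite -subr_ge0 (_ : _ - _ = h1 ^+ 2 + h2 ^+ 2 + (x1 * h2 - x2 * h1) ^+ 2).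
    by rewrite !addr_ge0 ?sqr_ge0.
  by rewrite /A; ring.
pose V := A^-1.
have V0 : 0 < V by rewrite invr_gt0.
have V1 : V <= 1 by rewrite invf_le1.
rewrite [leLHS](_ : _ = 4 * density x1 x2 + t ^+ 2 * (16 * ((x1 * h1 + x2 * h2) ^+ 2
   + N ^+ 2 * h ^+ 2 * (x1 * a + x2 * b) ^+ 2) * V ^+ 3 - (h1 ^+ 2 + h2 ^+ 2 + N ^+ 2 * h ^+ 2) * V ^+ 2)).
  rewrite lerD2l ler_wpM2l ?sqr_ge0//.
  have -> : N ^+ 2 * h ^+ 2 / (2 * A ^+ 2) = N ^+ 2 * h ^+ 2 * V ^+ 2 / 2.
    by rewrite /V; field; rewrite gt_eqF.
  have H0 : 0 <= h1 ^+ 2 + h2 ^+ 2 by rewrite addr_ge0 ?sqr_ge0.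
  have N0 : 0 <= N ^+ 2 * h ^+ 2 by rewrite mulr_ge0 ?sqr_ge0.
  have V2 : 0 <= V ^+ 2 by exact: sqr_ge0.
  have V21 : V ^+ 2 <= 1 by rewrite exprn_ile1// ltW.
  have V3 : 0 <= V ^+ 3 by rewrite exprn_ge0// ltW.
  have V32 : V ^+ 3 <= V ^+ 2 by rewrite exprS ler_piMl.
  have B1 : (x1 * h1 + x2 * h2) ^+ 2 * V ^+ 3 <= h1 ^+ 2 + h2 ^+ 2.
    apply: (le_trans (ler_wpM2r V3 xh)).
    have -> : A * (h1 ^+ 2 + h2 ^+ 2) * V ^+ 3 = (h1 ^+ 2 + h2 ^+ 2) * V ^+ 2.
      by rewrite /V; field; rewrite gt_eqF.
    by rewrite ler_piMr.
  (* Here [16 * (1 / 32) = 1 / 2]: near-orthogonality lets half of the negative term survive. *)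
  have B2 : N ^+ 2 * h ^+ 2 * (x1 * a + x2 * b) ^+ 2 * V ^+ 3 <= N ^+ 2 * h ^+ 2 * V ^+ 2 / 32.
    rewrite -(mulrA (N ^+ 2 * h ^+ 2)) -[leRHS]mulrA ler_wpM2l//.
    apply: (le_trans (ler_wpM2r V3 xt)); rewrite mul1r mulrC.
    by rewrite ler_wpM2r.
  have B3 : 0 <= (h1 ^+ 2 + h2 ^+ 2) * V ^+ 2 by rewrite mulr_ge0.
  by move: B1 B2 B3; lra.
rewrite (_ : t ^+ 2 * (16 * _ * V ^+ 3 - _) = 16 * (t ^+ 2 * ((x1 * h1 + x2 * h2) ^+ 2
   + N ^+ 2 * h ^+ 2 * (x1 * a + x2 * b) ^+ 2)) * V ^+ 3 -
   t ^+ 2 * (h1 ^+ 2 + h2 ^+ 2 + N ^+ 2 * h ^+ 2) * V ^+ 2); last by ring.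
rewrite -Ed -Ee /V !exprVn; ring.
Qed.

Lemma sqr_le_norm (y e : R) : `|y| <= e -> y ^+ 2 <= e ^+ 2.
Proof.
move=> ye; have e0 : 0 <= e by exact: le_trans ye.
by rewrite -real_normK ?num_real// ler_pXn2r ?nnegrE.
Qed.

(** By Lagrange's identity the square is at most [2 / 16^2], as [(a, b)] is a unit vector orthogonal
    to [(z1, z2)]. *)
Let near_orthogonal (z1 z2 x1 x2 a b : R) : a ^+ 2 + b ^+ 2 = 1 -> z1 * a + z2 * b = 0 ->
  `|x1 - z1| <= 1 / 16 -> `|x2 - z2| <= 1 / 16 -> (x1 * a + x2 * b) ^+ 2 <= 1 / 32.
Proof.
move=> ab zab /sqr_le_norm A /sqr_le_norm B.
have -> : x1 * a + x2 * b = (x1 - z1) * a + (x2 - z2) * b.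
  by rewrite !mulrBl addrACA -opprD zab subr0.
have : ((x1 - z1) * a + (x2 - z2) * b) ^+ 2 + ((x1 - z1) * b - (x2 - z2) * a) ^+ 2
    = (x1 - z1) ^+ 2 + (x2 - z2) ^+ 2.
  by rewrite -[RHS]mulr1 -ab; ring.
have := sqr_ge0 ((x1 - z1) * b - (x2 - z2) * a).
move: A B; move: ((x1 - z1) ^+ 2) ((x2 - z2) ^+ 2) => p q.
by move: ((_ + _) ^+ 2) ((_ - _) ^+ 2) => v w; lra.
Qed.

Let small_step (t C y1 y2 : R) : 0 < t -> t * C <= 1 / 4 -> `|y1| <= C -> `|y2| <= C ->
  (t * y1) ^+ 2 + (t * y2) ^+ 2 <= 1 / 8.
Proof.
move=> t0 tC.
have small y : `|y| <= C -> (t * y) ^+ 2 <= (1 / 4) ^+ 2.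
  by move=> yC; apply: sqr_le_norm; rewrite normrM gtr0_norm// (le_trans _ tC)// ler_pM2l.
by move=> /small A /small B; move: A B; move: ((t * y1) ^+ 2) ((t * y2) ^+ 2) => p q; lra.
Qed.

Let sqr_le_shift (x z : R) : `|x - z| <= 1 / 16 -> x ^+ 2 <= (`|z| + 1) ^+ 2.
Proof.
move=> xz; apply: sqr_le_norm; rewrite -(subrK z x); apply: (le_trans (ler_normD _ _)).
by move: xz; lra.
Qed.

(** [B] dominates [1 + x1^2 + x2^2] for all gradients close to [(z1, z2)], so that apart from [h]
    neither gain nor loss depends on the point any more. *)
Lemma oscillating_variation_near (z1 z2 x1 x2 a b h h1 h2 N t c s C C0 : R)
    (B := 1 + ((`|z1| + 1) ^+ 2 + (`|z2| + 1) ^+ 2))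
    (yc1 := h1 * c - N * a * (h * s)) (yc2 := h2 * c - N * b * (h * s))
    (ys1 := h1 * s + N * a * (h * c)) (ys2 := h2 * s + N * b * (h * c)) :
  c ^+ 2 + s ^+ 2 = 1 -> a ^+ 2 + b ^+ 2 = 1 -> z1 * a + z2 * b = 0 ->
  `|x1 - z1| <= 1 / 16 -> `|x2 - z2| <= 1 / 16 -> 0 < t -> t * C <= 1 / 4 ->
  `|h1| <= C0 -> `|h2| <= C0 -> `|yc1| <= C -> `|yc2| <= C -> `|ys1| <= C -> `|ys2| <= C ->
  density (x1 + t * yc1) (x2 + t * yc2) + density (x1 - t * yc1) (x2 - t * yc2) +
  (density (x1 + t * ys1) (x2 + t * ys2) + density (x1 - t * ys1) (x2 - t * ys2)) +
    t ^+ 2 * (N ^+ 2 * h ^+ 2 / (2 * B ^+ 2)) <=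
  4 * density x1 x2 + t ^+ 2 * (16 * (2 * C0 ^+ 2)).
Proof.
move=> cs ab zab d1 d2 t0 tC hC1 hC2 c1 c2 s1 s2.
have := @oscillating_variation_le x1 x2 a b h h1 h2 N t c s cs ab
  (near_orthogonal ab zab d1 d2) (small_step t0 tC c1 c2) (small_step t0 tC s1 s2).
rewrite -/yc1 -/yc2 -/ys1 -/ys2.
move: (density (_ + _) (_ + _)) (density (_ - _) (_ - _))
  (density (_ + _) (_ + _)) (density (_ - _) (_ - _)) => D1 D2 D3 D4 main.
rewrite -lerBrDr; apply: (le_trans main); rewrite -addrA lerD2l -mulrBr ler_pM2l ?exprn_gt0//.
have A1 : 1 <= 1 + (x1 ^+ 2 + x2 ^+ 2) by rewrite lerDl addr_ge0 ?sqr_ge0.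
have AB : 1 + (x1 ^+ 2 + x2 ^+ 2) <= B by rewrite lerD2l lerD ?sqr_le_shift.
move: A1 AB; move: (1 + (_ + _)) B => A B' A1 AB.
have A0 : 0 < A by exact: lt_le_trans A1.
have B0 : 0 < B' by exact: lt_le_trans AB.
apply: lerB; last first.
  apply: ler_wpM2l; first by apply: mulr_ge0; exact: sqr_ge0.
  have [A20 B20] : 0 < 2 * A ^+ 2 /\ 0 < 2 * B' ^+ 2.
    by split; apply: mulr_gt0 => //; exact: exprn_gt0.
  by rewrite lef_pV2// ler_pM2l// ler_pXn2r// nnegrE ltW.
by rewrite ler_pM2l// mulr_natl mulr2n lerD ?sqr_le_norm.
Qed.

Lemma unit_orthogonal (x1 x2 : R) :
  exists a b : R, a ^+ 2 + b ^+ 2 = 1 /\ x1 * a + x2 * b = 0.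
Proof.
have [n0|n0] := eqVneq (x1 ^+ 2 + x2 ^+ 2) 0.
  have x20 : x2 = 0.
    by apply/eqP; move/eqP: n0; rewrite paddr_eq0 ?sqr_ge0// !sqrf_eq0 => /andP[].
  by exists 0, 1; rewrite expr0n expr1n add0r mulr0 x20 mul0r addr0.
have n_gt0 : 0 < x1 ^+ 2 + x2 ^+ 2 by rewrite lt_neqAle eq_sym n0 addr_ge0 ?sqr_ge0.
pose n := Num.sqrt (x1 ^+ 2 + x2 ^+ 2).
have nn : n ^+ 2 = x1 ^+ 2 + x2 ^+ 2 by rewrite sqr_sqrtr// ltW.
have nz : n != 0 by rewrite gt_eqF// sqrtr_gt0.
exists (- x2 / n), (x1 / n); split; last by field.
by rewrite !exprMn !exprVn nn sqrrN -mulrDl addrC divff.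
Qed.
End SecondVariation.

(** * Measure and topology of squares *)

Section Squares.
Context {R : realType}.
Implicit Types (p x : R * R).
Local Notation lebesgue2 := (@lebesgue_measure R \x @lebesgue_measure R)%E.

Lemma squareE p (r : R) : square p r =
  `[p.1 - r, p.1 + r]%classic `*` `[p.2 - r, p.2 + r]%classic.
Proof.
apply/seteqP; split=> [x [x1 x2]|x [/=]].
  by split; rewrite /= in_itv/= -ler_distl.
by rewrite !in_itv/= -!ler_distl.
Qed.

Lemma measurable_square p (r : R) : measurable (square p r).
Proof. by rewrite squareE; apply: measurableX; exact: measurable_itv. Qed.

Lemma lebesgue2_square p (r : R) : 0 <= r -> lebesgue2 (square p r) = (4 * r ^+ 2)%:E.
Proof.
rewrite le_eqVlt => r0; rewrite squareE product_measure1E; do ?exact: measurable_itv.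
have E (a : R) : lebesgue_measure (`[a - r, a + r]%classic : set R) = (2 * r)%:E.
  rewrite lebesgue_measure_itv/= lte_fin; case/orP: r0 => [/eqP <-|r0].
    by rewrite subr0 addr0 ltxx mulr0.
  rewrite ifT; last by lra.
  by rewrite -EFinB; congr EFin; ring.
transitivity ((2 * r)%:E * (2 * r)%:E)%E; first by congr (_ * _)%E; exact: E.
by rewrite -EFinM; congr EFin; ring.
Qed.

Lemma integral_square p (r c : R) : 0 <= r -> 0 <= c ->
  (\int[lebesgue2]_x (c * \1_(square p r) x)%:E = (c * (4 * r ^+ 2))%:E)%E.
Proof.
move=> r0 c0; under eq_integral do rewrite EFinM.
rewrite ge0_integralZl//.
- by have mS := measurable_square p r; rewrite integral_indic// setIT EFinM;
    congr (_ * _)%E; exact: lebesgue2_square.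
- by apply/measurable_EFinP; apply/measurable_indicP; exact: measurable_square.
Qed.

Lemma closed_square p (r : R) : closed (square p r).
Proof.
have -> : square p r = [set x | `|x.1 - p.1| <= r] `&` [set x | `|x.2 - p.2| <= r] by [].
have c1 : continuous (fun x : R * R => `|x.1 - p.1|).
  by move=> x; apply: cvg_norm; apply: cvgB; [exact: cvg_fst|exact: cvg_cst].
have c2 : continuous (fun x : R * R => `|x.2 - p.2|).
  by move=> x; apply: cvg_norm; apply: cvgB; [exact: cvg_snd|exact: cvg_cst].
by apply: closedI; [apply: (closed_comp _ (@closed_le R r))|apply: (closed_comp _ (@closed_le R r))] => x _;
  [exact: c1|exact: c2].
Qed.

End Squares.

(** * The bump function *)

Section Bump.
Context {R : realType}.
Implicit Types (p x : R * R).

Lemma pospart2_eq0 (y : R) : y <= 0 -> pospart2 y = 0.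
Proof. by move=> y0; rewrite /pospart2 max_r// expr0n. Qed.

(** A product of four [pospart2] of affine functions, one per side of the square. On the half-size
    square each factor is at least [(r / 2)^2], hence [m = (r / 2)^8]. *)
Lemma bump p (r : R) : 0 < r -> exists chi chi1 chi2 (m : R),
  [/\ C11 chi chi1 chi2, 0 < m,
    forall x, r <= `|x.1 - p.1| \/ r <= `|x.2 - p.2| -> chi x = 0 &
    forall x, square p (r / 2) x -> m <= chi x].
Proof.
move=> r0.
have atom (a b d : R) := C11_linear (lexx (`|a| + `|b| + `|d|)) (pospart2_bound _).
have CA := C11M (C11M (atom (-1) 0 (r + p.1)) (atom 1 0 (r - p.1)))
                (C11M (atom 0 (-1) (r + p.2)) (atom 0 1 (r - p.2))).
set chi := (X in C11 X _ _) in CA.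
have chiE x : chi x = (pospart2 (r - (x.1 - p.1)) * pospart2 (r + (x.1 - p.1))) *
                      (pospart2 (r - (x.2 - p.2)) * pospart2 (r + (x.2 - p.2))).
  by congr ((pospart2 _ * pospart2 _) * (pospart2 _ * pospart2 _)); ring.
have pair0 (y : R) : r <= `|y| -> pospart2 (r - y) * pospart2 (r + y) = 0.
  rewrite ler_normr => /orP[yr|yr].
    by rewrite pospart2_eq0 ?mul0r// subr_le0.
  by rewrite (@pospart2_eq0 (r + y)) ?mulr0//; lra.
have pair_ge (y : R) : `|y| <= r / 2 -> ((r / 2) ^+ 2) ^+ 2 <= pospart2 (r - y) * pospart2 (r + y).
  rewrite ler_norml => /andP[y1 y2].
  have ge (z : R) : r / 2 <= z -> (r / 2) ^+ 2 <= pospart2 z.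
    move=> rz; rewrite /pospart2 ler_pXn2r// ?nnegrE ?divr_ge0 ?(ltW r0)//.
      by rewrite le_max rz.
    by rewrite le_max lexx orbT.
  by rewrite expr2 ler_pM ?sqr_ge0// ge//; lra.
exists chi; do 2!eexists; exists (((r / 2) ^+ 2) ^+ 2 * ((r / 2) ^+ 2) ^+ 2); split.
- exact: CA.
- by rewrite mulr_gt0// !exprn_gt0// divr_gt0.
- by move=> x; rewrite chiE => -[/pair0 ->|/pair0 ->]; rewrite ?mul0r ?mulr0.
- by move=> x [x1 x2]; rewrite chiE ler_pM ?sqr_ge0 ?pair_ge.
Qed.

End Bump.

(** * A point where neither constraint is active *)

Section Interior.
Local Opaque partial.
Context {R : realType}.
Variables (M : R) (u : R * R -> R) (U : set (R * R)).
Hypotheses (uC : concave_on unit_disc u) (oU : open U) (UD : U `<=` unit_disc).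
Hypothesis u_bounded : forall x, unit_disc x -> 0 <= u x <= M.
Hypotheses (u2 : C2_on U u) (uH : forall p, U p -> hessian u p \in unitmx).

(** Averaging the gap inequality over [p + (r, 0)] and [p - (r, 0)] cancels the slope and gives
    [u p >= k r^2], because [u >= 0] at both points. *)
Lemma strong_concavity_gt0 p : U p -> 0 < u p.
Proof.
move=> Up; have [r [k [r0 k0 rU uS]]] := strong_concavity uC oU UD u2 Up (uH Up).
have pp : square p r p by split; rewrite subrr normr0 ltW.
have H (s : R) : `|s| = r -> unit_disc (p.1 + s, p.2).
  by move=> sr; apply/UD/rU; split; rewrite /= ?subrr ?normr0 ?(ltW r0)// addrC addKr sr.
have D1 : unit_disc (p.1 + r, p.2) by apply: H; rewrite gtr0_norm.
have D2 : unit_disc (p.1 + - r, p.2) by apply: H; rewrite normrN gtr0_norm.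
have := uS p _ pp D1; have := uS p _ pp D2.
have /andP[+ _] := u_bounded D1; have /andP[+ _] := u_bounded D2.
rewrite /= subrr !(addrC p.1) !addrK.
generalize (partial ord0 u p) (partial ord_max u p) (u (r + p.1, p.2)) (u (- r + p.1, p.2)) (u p).
move=> g1 g2 a b c a0 b0 A B.
have : 0 < k * r ^+ 2 by rewrite mulr_gt0// exprn_gt0.
move: A B; lra.
Qed.

(** If [u p = M], the point [p + (r, 0)] works: the gap at the midpoint, where [u <= M], makes the
    sum of the two end values less than [2 M]. *)
Lemma exists_strictly_between : U !=set0 -> exists2 p, U p & 0 < u p < M.
Proof.
move=> [p Up]; have [r [k [r0 k0 rU uS]]] := strong_concavity uC oU UD u2 Up (uH Up).
have [uM|Mu] := ltP (u p) M; first by exists p => //; rewrite strong_concavity_gt0.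
have sq (s : R) : 0 <= s <= r -> square p r (p.1 + s, p.2).
  move=> /andP[s0 sr]; split; rewrite /= ?subrr ?normr0 ?(ltW r0)//.
  by rewrite addrC addKr ger0_norm.
have qr : square p r (p.1 + r, p.2) by apply: sq; rewrite (ltW r0) lexx.
have qr2 : square p r (p.1 + r / 2, p.2) by apply: sq; apply/andP; split; lra.
exists (p.1 + r, p.2); first exact: rU.
rewrite strong_concavity_gt0 ?andTb; last exact: rU.
have := uS _ _ qr2 (UD Up); have := uS _ _ qr2 (UD (rU _ qr)).
have /andP[_] := u_bounded (UD (rU _ qr2)); move: Mu => /=.
rewrite subrr (_ : p.1 + r - (p.1 + r / 2) = r / 2); last by field.
rewrite (_ : p.1 - (p.1 + r / 2) = - (r / 2)); last by ring.
generalize (partial ord0 u (p.1 + r / 2, p.2)) (partial ord_max u (p.1 + r / 2, p.2)).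
generalize (u (p.1 + r, p.2)) (u p) (u (p.1 + r / 2, p.2)).
move=> a b c g1 g2 bM cM A B.
have : 0 < k * (r / 2) ^+ 2 by rewrite mulr_gt0// exprn_gt0// divr_gt0.
move: A B; lra.
Qed.

End Interior.

(** * The resistance as an integral over the plane *)

Section Resistance.
Context {R : realType}.
Implicit Types (w : R * R -> R) (x : R * R).
Local Notation lebesgue2 := (@lebesgue_measure R \x @lebesgue_measure R)%E.

Definition integrand w x : R :=
  if x \in unit_disc then density (partial ord0 w x) (partial ord_max w x) else 0.

Lemma density_gt0 (a b : R) : 0 < density a b.
Proof. by rewrite /density invr_gt0 ltr_pwDl// addr_ge0 ?sqr_ge0. Qed.

Lemma density_le1 (a b : R) : density a b <= 1.
Proof. by rewrite /density invf_le1 ?lerDl ?ltr_pwDl// addr_ge0 ?sqr_ge0. Qed.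

Lemma integrand_ge0 w x : 0 <= integrand w x.
Proof. by rewrite /integrand; case: ifP => // _; exact/ltW/density_gt0. Qed.

Lemma resistanceE w : resistance w = (\int[lebesgue2]_x (integrand w x)%:E)%E.
Proof.
rewrite /resistance integral_mkcond; apply: eq_integral => x _.
by rewrite patchE /integrand; case: ifP.
Qed.

Lemma resistance_lty w : (\int[lebesgue2]_x (integrand w x)%:E < +oo)%E.
Proof.
apply: (@le_lt_trans _ _ (\int[lebesgue2]_x (1 * \1_(square (0, 0) 1) x : R)%:E)%E); last first.
  by rewrite integral_square// ltry.
apply: le_integral_ge0 => [x|x]; first exact: integrand_ge0.
rewrite /integrand mul1r indicE; case: ifPn => [/set_mem Dx|_]; last by case: (_ \in _).
rewrite mem_set ?density_le1//.
by have [x1 x2] := unit_disc_le1 Dx; split; rewrite /= subr0.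
Qed.

End Resistance.

(** * Gradient of the perturbed function *)

Section PartialPerturbation.
Context {R : realType}.
Variables (u phi phi1 phi2 : R * R -> R) (U : set (R * R)) (p : R * R) (r t : R).
Hypotheses (oU : open U) (UD : U `<=` unit_disc) (u2 : C2_on U u).
Hypothesis phiC : C11 phi phi1 phi2.
Hypothesis phi0 : forall x, r <= `|x.1 - p.1| \/ r <= `|x.2 - p.2| -> phi x = 0.
Local Notation w := (fun x => u x + t * phi x).

Lemma partial_perturbation x : U x ->
  partial ord0 w x = partial ord0 u x + t * phi1 x /\
  partial ord_max w x = partial ord_max u x + t * phi2 x.
Proof.
move=> Ux; have nD : nbhs x unit_disc by apply: filterS UD _; exact: open_nbhs_nbhs.
have [d1 d2] := C11_is_derive phiC nD.
have du i : derivable u x (dirvec i) by have [_ /(_ i i)[]] := u2 Ux.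
have aux i dphi : is_derive x (dirvec i) phi dphi ->
    'D_(dirvec i) w x = 'D_(dirvec i) u x + t * dphi.
  move=> dp; have -> : w = u + (t \*: phi) by [].
  have du' : is_derive x (dirvec i) u ('D_(dirvec i) u x) by split.
  exact: (@derive_val _ _ _ _ _ _ _ (is_deriveD du' (is_deriveZ t dp))).
by split; rewrite /partial; apply: aux.
Qed.

(** The complement of the closed square is open and both functions agree on it, so their difference
    quotients agree for small steps. This covers points where [u] is not differentiable and those on
    the circle. *)
Lemma partial_unperturbed i x : ~ square p r x -> partial i w x = partial i u x.
Proof.
move=> px; rewrite /partial; apply: near_eq_derive.
have : nbhs x (~` square p r).
  by apply: open_nbhs_nbhs; split => //; apply: closed_openC; exact: closed_square.
apply: filterS => y py; rewrite phi0 ?mulr0 ?addr0//.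
have [y1|y1] := leP r `|y.1 - p.1|; first by left.
by right; rewrite leNgt; apply/negP => y2; apply: py; split; apply: ltW.
Qed.

End PartialPerturbation.

(** * Contradiction with minimality *)

Section NotSolution.
Local Opaque partial.
Context {R : realType}.

Let add_between (m K v e : R) : m <= v -> v <= K - m -> - m <= e -> e <= m ->
  0 <= v + e <= K.
Proof. by move=> *; apply/andP; split; lra. Qed.

Let add4 (v : R) : v + v + (v + v) = 4 * v.
Proof. by ring. Qed.

Variables (M : R) (u : R * R -> R) (U : set (R * R)).
Hypotheses (uC : concave_on unit_disc u) (oU : open U) (UD : U `<=` unit_disc).
Hypothesis u_bounded : forall x, unit_disc x -> 0 <= u x <= M.
Hypotheses (u2 : C2_on U u) (uH : forall p, U p -> hessian u p \in unitmx).

Lemma nondegenerate_not_solution : U !=set0 -> ~ is_solution M u.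
Proof.
move=> U0 [_ umin].
have [p Up /andP[up0 upM]] := exists_strictly_between uC oU UD u_bounded u2 uH U0.
have [r1 [k [r10 k0 rU uS]]] := strong_concavity uC oU UD u2 Up (uH Up).
(* Half the distance from [u p] to the constraints: one [m] is spent on the variation of [u] near
   [p], the other on the perturbation. *)
pose m := Num.min (u p) (M - u p) / 2.
have m0 : 0 < m by rewrite divr_gt0// lt_min up0 subr_gt0.
have mu : m <= u p / 2 by rewrite ler_pM2r// ge_min lexx.
have mM : m <= (M - u p) / 2 by rewrite ler_pM2r// ge_min lexx orbT.
have [uc /(_ ord0 ord0)[_ g1c _ _]] := u2 Up.
have [_ /(_ ord_max ord_max)[_ g2c _ _]] := u2 Up.
have n16 : 0 < 1 / 16 :> R by rewrite divr_gt0.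
pose close (F : R * R -> R) (e : R) : set (R * R) := [set q | `|F q - F p| <= e].
have /nbhs_squareP[r2 r20 r2P] : nbhs p (close u m `&`
    (close (partial ord0 u) (1 / 16) `&` close (partial ord_max u) (1 / 16))).
  exact: filterI (near_dist_le uc m0)
    (filterI (near_dist_le g1c n16) (near_dist_le g2c n16)).
pose r := Num.min (r1 / 3) r2.
have r0 : 0 < r by rewrite lt_min r20 divr_gt0.
have r3 : 3 * r <= r1 by rewrite mulrC -ler_pdivlMr// ge_min lexx.
have rr2 : r <= r2 by rewrite ge_min lexx orbT.
have rr1 : r <= r1 by apply: le_trans r3; lra.
have sqU : square p r `<=` U by apply: subset_trans rU; exact: square_le.
have sq3D : square p (3 * r) `<=` unit_disc.
  by apply: subset_trans UD; apply: subset_trans rU; exact: square_le.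
pose x1 := partial ord0 u p; pose x2 := partial ord_max u p.
have near_u x : square p r x -> m <= u x <= M - m.
  move=> /(square_le rr2)/r2P[]; rewrite /close/= ler_norml => /andP[A B] _.
  by move: A B mu mM; generalize (u x) => ux A B mu mM; apply/andP; split; lra.
have near_g x : square p r x -> `|partial ord0 u x - x1| <= 1 / 16 /\
    `|partial ord_max u x - x2| <= 1 / 16.
  by move=> /(square_le rr2)/r2P[_].
(* The direction [tau = (a, b)] is fixed once, at [p]; [near_g] keeps its product with the other
   gradients on the square small. *)
have [a [b [ab xab]]] := unit_orthogonal x1 x2.
have [chi [chi1 [chi2 [cm [chiC cm0 chi0 chi_ge]]]]] := bump p r0.
have [C0 chiC0] := chiC.
have C00 := C11_bound_ge0 chiC0.
pose G := 16 * (2 * C0 ^+ 2).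
pose Ab := 1 + ((`|x1| + 1) ^+ 2 + (`|x2| + 1) ^+ 2).
have Ab1 : 1 <= Ab by rewrite lerDl addr_ge0 ?sqr_ge0.
(* Chosen so that [N cm^2 > 8 G Ab^2]; as [N >= 1], this passes to [N^2]. In [NG] the factor 4 is
   the ratio of the areas of [square p r], where the loss occurs, and [square p (r / 2)], where the
   gain is counted. *)
pose N := 8 * G * Ab ^+ 2 / cm ^+ 2 + 1.
have G0 : 0 <= G by rewrite /G !mulr_ge0// sqr_ge0.
have N1 : 1 <= N by rewrite lerDr divr_ge0 ?sqr_ge0// mulr_ge0 ?sqr_ge0// mulr_ge0.
have NG : 4 * G < N ^+ 2 * cm ^+ 2 / (2 * Ab ^+ 2).
  have Ab0 : 0 < Ab by exact: lt_le_trans Ab1.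
  have Ab20 : 0 < Ab ^+ 2 by rewrite exprn_gt0.
  have cm20 : 0 < cm ^+ 2 by rewrite exprn_gt0.
  rewrite ltr_pdivlMr ?mulr_gt0//.
  have : 8 * G * Ab ^+ 2 < N * cm ^+ 2.
    have -> : N * cm ^+ 2 = 8 * G * Ab ^+ 2 + cm ^+ 2.
      by rewrite /N [LHS]mulrDl mul1r divfK// gt_eqF.
    by rewrite ltrDl.
  have : N * cm ^+ 2 <= N ^+ 2 * cm ^+ 2.
    by rewrite ler_pM2r// expr2 ler_peMl// (le_trans _ N1).
  by lra.
pose th (x : R * R) := (N * a) * x.1 + (N * b) * x.2 + 0.
pose B := `|N * a| + `|N * b| + `|0 : R|.
have cosC := C11_linear (lexx B) (ex_intro _ 1 (@cos_taylor_bound R B)).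
have sinC := C11_linear (lexx B) (ex_intro _ 1 (@sin_taylor_bound R B)).
have phicC := C11M chiC cosC; have phisC := C11M chiC sinC.
set phic := (X in C11 X _ _) in phicC; set phis := (X in C11 X _ _) in phisC.
set phic1 := (X in C11 _ X _) in phicC; set phis1 := (X in C11 _ X _) in phisC.
set phic2 := (X in C11 _ _ X) in phicC; set phis2 := (X in C11 _ _ X) in phisC.
have phic0 x : r <= `|x.1 - p.1| \/ r <= `|x.2 - p.2| -> phic x = 0.
  by rewrite /phic/= => /chi0 ->; rewrite mul0r.
have phis0 x : r <= `|x.1 - p.1| \/ r <= `|x.2 - p.2| -> phis x = 0.
  by rewrite /phis/= => /chi0 ->; rewrite mul0r.
have phic1E x : phic1 x = chi1 x * cos (th x) - N * a * (chi x * sin (th x)).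
  by rewrite /phic1 -/(th x); ring.
have phic2E x : phic2 x = chi2 x * cos (th x) - N * b * (chi x * sin (th x)).
  by rewrite /phic2 -/(th x); ring.
have phis1E x : phis1 x = chi1 x * sin (th x) + N * a * (chi x * cos (th x)).
  by rewrite /phis1 -/(th x); ring.
have phis2E x : phis2 x = chi2 x * sin (th x) + N * b * (chi x * cos (th x)).
  by rewrite /phis2 -/(th x); ring.
have [Cc phicB] := phicC; have [Cs phisB] := phisC.
pose C := Num.max Cc Cs.
have {}phicB : C11_bound C phic phic1 phic2 by apply: C11_bound_le phicB; rewrite le_max lexx.
have {}phisB : C11_bound C phis phis1 phis2 by apply: C11_bound_le phisB; rewrite le_max lexx orbT.
have C_ge0 := C11_bound_ge0 phicB.
(* The three bounds serve concavity ([k]), the constraints ([m]) and the step size in the second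
   difference ([1 / 4]). *)
pose t := Num.min (Num.min k m) (1 / 4) / (C + 1).
have C10 : 0 < C + 1 by rewrite ltr_wpDl.
have t0 : 0 < t by rewrite divr_gt0// !lt_min k0 m0 divr_gt0.
have tC : t * C <= Num.min (Num.min k m) (1 / 4).
  rewrite /t mulrAC ler_pdivrMr// ler_pM2l ?lerDl//.
  by rewrite !lt_min k0 m0 divr_gt0.
have tk : t * C <= k by apply: (le_trans tC); rewrite !ge_min lexx.
have tm : t * C <= m by apply: (le_trans tC); rewrite !ge_min lexx orbT.
have t4 : t * C <= 1 / 4 by apply: (le_trans tC); rewrite !ge_min lexx orbT.
have adm phi phi1 phi2 s : C11_bound C phi phi1 phi2 ->
    (forall x, r <= `|x.1 - p.1| \/ r <= `|x.2 - p.2| -> phi x = 0) -> `|s| = t ->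
    admissible M (fun x => u x + s * phi x).
  move=> phiB phi0 st; split.
    apply: (@perturbation_concave _ u phi phi1 phi2 (partial ord0 u) (partial ord_max u) p r k C) => //.
      by move=> c x /(square_le r3); exact: uS.
    by rewrite st.
  move=> x Dx; have [px|px] := pselect (square p r x).
    have /andP[A B'] := near_u x px.
    have : `|s * phi x| <= m.
      rewrite normrM st; apply: le_trans tm; rewrite ler_wpM2l ?(ltW t0)//.
      by have [] := phiB x Dx.
    by rewrite ler_norml => /andP[]; exact: add_between.
  rewrite phi0 ?mulr0 ?addr0; first exact: u_bounded.
  have [y1|y1] := leP r `|x.1 - p.1|; first by left.
  by right; rewrite leNgt; apply/negP => y2; apply: px; split; apply: ltW.
(* Opposite signs cancel the first-order terms, and the cosine and sine pairs remove the
   oscillation. *)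
pose W (i : 'I_4) x := match val i with
  | 0 => u x + t * phic x | 1 => u x + - t * phic x
  | 2 => u x + t * phis x | _ => u x + - t * phis x end.
have Wmin i : (resistance u <= resistance (W i))%E.
  apply: umin; have tt : `|t| = t by rewrite gtr0_norm.
  have ntt : `|- t| = t by rewrite normrN.
  case: i => -[|[|[|]]] ?; rewrite /W/=.
  - exact: adm phicB _ tt.
  - exact: adm phicB _ ntt.
  - exact: adm phisB _ tt.
  - by move=> _; exact: adm phisB _ ntt.
pose H := N ^+ 2 * cm ^+ 2 / (2 * Ab ^+ 2).
have H0 : 0 < H by apply: le_lt_trans NG; rewrite mulr_ge0.
have t20 : 0 < t ^+ 2 by rewrite exprn_gt0.
(* The gain is counted only where [chi >= cm]; elsewhere it is nonnegative and dropped. The loss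
   [h2] is charged on the whole support square. *)
pose h1 x := t ^+ 2 * H * \1_(square p (r / 2)) x.
pose h2 x := t ^+ 2 * G * \1_(square p r) x.
have r20' : 0 <= r / 2 by rewrite divr_ge0// ltW.
suff : (t ^+ 2 * H) * (4 * (r / 2) ^+ 2) <= (t ^+ 2 * G) * (4 * r ^+ 2).
  have -> : (t ^+ 2 * H) * (4 * (r / 2) ^+ 2) = t ^+ 2 * r ^+ 2 * H by field.
  have -> : (t ^+ 2 * G) * (4 * r ^+ 2) = t ^+ 2 * r ^+ 2 * (4 * G) by ring.
  rewrite ler_pM2l; last by rewrite mulr_gt0 ?exprn_gt0.
  by apply/negP; rewrite -ltNge.
have tH : 0 <= t ^+ 2 * H by rewrite mulr_ge0 ?ltW.
have tG : 0 <= t ^+ 2 * G by rewrite mulr_ge0// ltW.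
rewrite -lee_fin -(integral_square p r20' tH) -(integral_square p (ltW r0) tG).
apply: (@lower_integral_comparison _ _ R (@lebesgue_measure R \x @lebesgue_measure R)%E 3
  (integrand u) (fun i => integrand (W i)) h1 h2).
- exact: integrand_ge0.
- by move=> i x; exact: integrand_ge0.
- by apply: measurable_funM => //; apply/measurable_indicP; exact: measurable_square.
- by apply: measurable_funM => //; apply/measurable_indicP; exact: measurable_square.
- by move=> x; apply: mulr_ge0 => //; rewrite indicE; case: (_ \in _).
- by move=> x; apply: mulr_ge0 => //; rewrite indicE; case: (_ \in _).
- exact: resistance_lty.
- by move=> i; have := Wmin i; rewrite !resistanceE.
move=> x; rewrite !big_ord_recl big_ord0 addr0 -/(h1 x) -/(h2 x).
have split_sum (f0 f1 f2 f3 : R) : f0 + (f1 + (f2 + f3)) = f0 + f1 + (f2 + f3).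
  by rewrite addrA.
rewrite split_sum.
(* Off the square all four integrands equal that of [u], and [h1] and [h2] vanish. *)
have [px|px] := pselect (square p r x); last first.
  have Wu i : integrand (W i) x = integrand u x.
    rewrite /integrand; case: ifP => // _.
    by case: i => -[|[|[|]]] ?; rewrite /W/= !(@partial_unperturbed _ u _ p r).
  rewrite !Wu /h1 /h2 !indicE (memNset px) (memNset (_ : ~ square p (r / 2) x)).
    by rewrite !mulr0 !addr0 add4.
  apply: contra_not px; apply: square_le.
  by rewrite ler_pdivrMr// ler_pMr// ler1n.
have Ux := sqU x px; have Dx := UD Ux.
have [wc1 wc2] := partial_perturbation t oU UD u2 phicC Ux.
have [wc1' wc2'] := partial_perturbation (- t) oU UD u2 phicC Ux.
have [ws1 ws2] := partial_perturbation t oU UD u2 phisC Ux.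
have [ws1' ws2'] := partial_perturbation (- t) oU UD u2 phisC Ux.
rewrite /integrand !(mem_set Dx) /W/= wc1 wc2 wc1' wc2' ws1 ws2 ws1' ws2'.
rewrite !mulNr phic1E phic2E phis1E phis2E.
have [g1 g2] := near_g x px.
have [_ cb1 cb2 _] := phicB x Dx; have [_ sb1 sb2 _] := phisB x Dx.
have [_ hb1 hb2 _] := chiC0 x Dx.
have h1x : h1 x <= t ^+ 2 * (N ^+ 2 * chi x ^+ 2 / (2 * Ab ^+ 2)).
  rewrite /h1 -mulrA ler_pM2l// indicE.
  have [hx|hx] := pselect (square p (r / 2) x); last first.
    rewrite memNset// mulr0; apply: divr_ge0; apply: mulr_ge0 => //; exact: sqr_ge0.
  have chx : 0 <= chi x by exact: le_trans (ltW cm0) (chi_ge x hx).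
  rewrite mem_set// mulr1 /H ler_wpM2r//.
    by rewrite invr_ge0; apply: mulr_ge0 => //; exact: sqr_ge0.
  rewrite ler_wpM2l ?sqr_ge0// ler_pXn2r ?nnegrE ?(ltW cm0)//.
  exact: chi_ge.
have -> : h2 x = t ^+ 2 * G by rewrite /h2 indicE mem_set// mulr1.
move: cb1 cb2 sb1 sb2; rewrite phic1E phic2E phis1E phis2E => cb1 cb2 sb1 sb2.
have main := oscillating_variation_near (cos2Dsin2 (th x)) ab xab g1 g2 t0 t4 hb1 hb2 cb1 cb2 sb1 sb2.
by apply: le_trans main; rewrite lerD2l.
Qed.
End NotSolution.

Theorem corollary3 (R : realType) (M : R) (u : R * R -> R)
    (M_gt0 : 0 < M)
    (u_concave : concave_on unit_disc u)
    (u_bounded : forall p, unit_disc p -> 0 <= u p <= M)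
    (u_C2 : exists U : set (R * R),
      [/\ U !=set0, open U, U `<=` unit_disc, C2_on U u
        & forall p, U p -> hessian u p \in unitmx]) :
  ~ is_solution M u \/
  exists L : set ({charge set S2 R -> \bar R}),
    [/\ linear_space L, infinite_dimensional L
      & forall nu', L nu' ->
          exists2 eps : R, 0 < eps &
            forall s : R, s \in `[- eps, eps] ->
              exists2 w, is_solution M w &
                forall A : set (S2 R), measurable A ->
                  corresponding_measure w A =
                  (corresponding_measure u A + s%:E * nu' A)%E].
Proof.
left; have [U [U0 oU UD u2 uH]] := u_C2.
exact: nondegenerate_not_solution u_concave oU UD u_bounded u2 uH U0.
Qed.
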